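(* Let $\mathcal{A}=(S_i)_{i\in E}$, $E=\{1,\ldots,N\}$, be a signed pseudosphere arrangement in $\mathbb{S}^d$ that is not semigeneral. Then the Varchenko matrix $V(\mathcal{A})$ does not have a diagonal form over $\mathbb{Z}[x_1,\ldots,x_N]$.
   Context: $\mathbb{S}^d$ is the unit sphere in $\mathbb{R}^{d+1}$. A pseudosphere is the image of the equator $\{x\in\mathbb{S}^d:x_{d+1}=0\}$ under a homeomorphism of $\mathbb{S}^d$; it divides $\mathbb{S}^d$ into two closed sides $S^+,S^-$. A pseudosphere arrangement $(S_e)_{e\in E}$ is a finite family of pseudospheres such that each intersection $S_B=\bigcap_{e\in B}S_e$ ($S_\emptyset=\mathbb{S}^d$) is empty or homeomorphic to a sphere (whose dimension is $\dim S_B$), and whenever $S_B\ne\emptyset$, $S_B\not\subseteq S_e$, the set $S_B\cap S_e$ is a pseudosphere in $S_B$ dividing it into $S_B\cap S_e^\pm$; signed means the sides are designated. The arrangement is semigeneral if $S_B\neq\emptyset$ implies $\dim S_B=d-|B|$ for all $B\subseteq E$. Regions are the connected components of $\mathbb{S}^d\setminus\bigcup_e S_e$, with sign vectors $X^R\in\{+,-\}^E$ recording the side of each $S_e$ containing $R$. The Varchenko matrix is indexed by regions with $(R,R')$ entry $\prod_{e:\,X^R_e=-X^{R'}_e}x_e$, where $x_e$ is an indeterminate attached to $S_e$. A square matrix $A$ over a ring $R$ has a diagonal form if there are matrices $P,Q$ over $R$ with unit determinants such that $PAQ$ is diagonal.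
   Formalization: The pseudospheres S_1,…,S_N are assumed pairwise distinct as sets; with repetitions the claim fails, e.g. two equal pseudospheres in S^1 with the same sides give a matrix with diagonal form diag(1, 1 − x_1²x_2²). *)

(* Defs.v *)
From HB Require Import structures.
From mathcomp Require Import all_boot all_order all_algebra.
From mathcomp Require Import finmap.
From mathcomp Require Import all_classical all_reals all_analysis.
(* Only its canonical structures: the notations of mpoly clash with those of
   analysis. *)
From mathcomp Require mpoly.
Export (canonicals) mpoly.

Set Implicit Arguments.
Unset Strict Implicit.
Unset Printing Implicit Defensive.

Import Order.TTheory GRing.Theory Num.Theory.
Import numFieldNormedType.Exports.

Local Open Scope classical_set_scope.
Local Open Scope ring_scope.

Definition unit_sphere (R : realType) (d : nat) : set 'rV[R]_d.+1 :=
  [set x | \sum_i x 0 i ^+ 2 = 1].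
Arguments unit_sphere : clear implicits.

Definition equator (R : realType) (d : nat) : set 'rV[R]_d.+1 :=
  unit_sphere R d `&` [set x | x 0 ord_max = 0].
Definition upper_hemisphere (R : realType) (d : nat) : set 'rV[R]_d.+1 :=
  unit_sphere R d `&` [set x | 0 <= x 0 ord_max].
Definition lower_hemisphere (R : realType) (d : nat) : set 'rV[R]_d.+1 :=
  unit_sphere R d `&` [set x | x 0 ord_max <= 0].
Arguments equator : clear implicits.
Arguments upper_hemisphere : clear implicits.
Arguments lower_hemisphere : clear implicits.

(* The values of f outside A are irrelevant. *)
Definition homeomorphism (T U : topologicalType) (A : set T) (B : set U)
    (f : T -> U) : Prop :=
  {within A, continuous f} /\
  exists g : U -> T,
    [/\ {within B, continuous g}, set_fun A B f, set_fun B A g,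
        {in A, cancel f g} & {in B, cancel g f}].

Section Arrangements.
Variable R : realType.

(* "dim X = k" is a relation: X is homeomorphic to the k-sphere. The empty set
   has no dimension here. *)
Definition sphere_dim (T : topologicalType) (X : set T) (k : nat) : Prop :=
  exists h : 'rV[R]_k.+1 -> T, homeomorphism (unit_sphere R k) X h.

(* Inside a k-sphere X, the set S is a pseudosphere dividing X into the closed
   sides P and M; the unsigned notion leaves P and M unspecified. *)
Definition pseudosphere (T : topologicalType) (k : nat) (X S P M : set T) :
    Prop :=
  exists h : 'rV[R]_k.+1 -> T,
    [/\ homeomorphism (unit_sphere R k) X h, S = h @` equator R k,
        P = h @` upper_hemisphere R k & M = h @` lower_hemisphere R k].

Section Flat.
Variables (d N : nat) (S : 'I_N -> set 'rV[R]_d.+1).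

(* The intersection with the sphere matters for B = set0 only. *)
Definition flat (B : {set 'I_N}) : set 'rV[R]_d.+1 :=
  unit_sphere R d `&` \bigcap_(e in [set` B]) S e.

End Flat.

Record signed_arrangement (d N : nat) := SignedArrangement {
  psphere : 'I_N -> set 'rV[R]_d.+1;
  pos_side : 'I_N -> set 'rV[R]_d.+1;
  neg_side : 'I_N -> set 'rV[R]_d.+1;
  psphereP : forall e,
    pseudosphere d (unit_sphere R d) (psphere e) (pos_side e) (neg_side e);
  flat_sphere : forall B,
    flat psphere B !=set0 -> exists k, sphere_dim (flat psphere B) k;
  flat_pseudosphere : forall B e,
    flat psphere B !=set0 -> ~ (flat psphere B `<=` psphere e) ->
    forall k, sphere_dim (flat psphere B) k ->
      pseudosphere k (flat psphere B) (flat psphere B `&` psphere e)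
        (flat psphere B `&` pos_side e) (flat psphere B `&` neg_side e)
}.

Section Varchenko.
Variables (d N : nat) (A : signed_arrangement d N).

Definition semigeneral : Prop :=
  forall B : {set 'I_N}, flat (psphere A) B !=set0 ->
    exists2 k, sphere_dim (flat (psphere A) B) k & (k + #|B|)%N = d.

Definition arr_complement : set 'rV[R]_d.+1 :=
  unit_sphere R d `\` \bigcup_e psphere A e.

Definition regions : set (set 'rV[R]_d.+1) :=
  [set C | exists2 x, arr_complement x & C = connected_component arr_complement x].

(* true stands for + *)
Definition region_sign (C : set 'rV[R]_d.+1) (e : 'I_N) : bool :=
  `[< C `<=` pos_side A e >].

(* There are finitely many regions; fset_set lists them in some order (and it
   would be empty for an infinite set). *)
Definition region_seq : seq (set 'rV[R]_d.+1) := fset_set regions.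

Definition varchenko : 'M[mpoly.mpoly N int]_(size region_seq) :=
  \matrix_(i, j)
    \prod_(e < N | region_sign (nth set0 region_seq i) e
                   != region_sign (nth set0 region_seq j) e)
      mpoly.mpolyX int (mpoly.mnm1 e).

End Varchenko.
End Arrangements.

Definition has_diagonal_form (K : comUnitRingType) n (V : 'M[K]_n) : Prop :=
  exists P Q : 'M[K]_n,
    [/\ \det P \is a GRing.unit, \det Q \is a GRing.unit
      & is_diag_mx (P *m V *m Q)].

(* Main.v *)
(** A non-semigeneral arrangement contains a circuit: a minimal [B] such that
[flat B] is nonempty and [flat (B :\ e) = flat B] for some, hence by exchange
for every, [e \in B]. Since open hemispheres are connected, the regions
realize all sign vectors on [B] except two opposite ones.

Suppose [P V Q = D] is diagonal. Let [p_J] be the point with [x_e = 1] for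
[e \notin B] or [e \in J], and [x_e = 0] otherwise. The number of [i] with
[D_ii (p_J) <> 0] is the rank of [V (p_J)], that is, the number of sign vectors
realized on [B :\: J]: [2 ^ #|B :\: J|], minus [2] when [J] is empty. When some
of the variables are set to [0] or [1], [V] acquires a generalized inverse
with denominator [\prod (1 - x_e ^+ 2)], and the nonzero entries of [D] divide
this denominator. Hence [D_ii (p_J) <> 0] if and only if [D_ii] vanishes
neither at the point of the empty set nor at any of the points [p_{e}],
[e \in J]. With [K_i] the set of [e \in B] such that [D_ii] vanishes at
[p_{e}], an alternating sum over [J] then gives [1 - 2 = -1] for the number
of [i] with [K_i = B]. *)

Require Import Defs.
From mathcomp Require Import all_boot all_order all_algebra.
From mathcomp Require Import all_classical all_reals all_analysis.
From mathcomp Require Import ring lra.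

Set Implicit Arguments.
Unset Strict Implicit.
Unset Printing Implicit Defensive.

Import Order.TTheory GRing.Theory Num.Theory.
Import numFieldNormedType.Exports.

Local Open Scope ring_scope.

(** * Ranks and diagonal forms *)

(** The matrix of the full cube is a Kronecker product of blocks [((1, x_e), (x_e, 1))], so its
    inverse has denominator [\prod (1 - x_e ^+ 2)]. Deleting the two missing vertices is a Schur
    complement, which divides by the block of the inverse on these vertices. Up to scaling this
    block has 1 on the diagonal and [\prod_(e in B) (- x_e)] off it. If some variable of [B] is 0,
    it is the identity and brings no new denominator; if some variable is 1, projecting along it
    restores the full cube and nothing is missing.

    With all variables of [B] free neither happens. The value at [p_B] is therefore reached inside a
    face where one variable is already 1, and this detour needs [2 < #|B|], hence distinct
    pseudospheres. Two equal ones are a genuine exception: [((1, x y), (x y, 1))] is equivalent to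
    the diagonal matrix with entries [1] and [1 - x^2 y^2].

    Finiteness of the set of regions also has to be proved: an infinite set would be listed as
    empty, and an empty matrix is diagonal. *)

Lemma mxrank_factor (F : fieldType) n r (A : 'M[F]_(n, r)) (B : 'M[F]_(r, n))
    (E : 'M[F]_(r, n)) (G : 'M[F]_(n, r)) :
  E *m A = 1%:M -> B *m G = 1%:M -> \rank (A *m B) = r.
Proof.
move=> EA BG; rewrite mxrankMfree; last by apply/row_freeP; exists G.
by apply/eqP; apply/row_fullP; exists E.
Qed.

(** This is the shape of V at a point with coordinates 0 and 1: an entry is 1 when the two sign
    vectors agree wherever the coordinate is 0, and 0 otherwise. The incidence matrix [A] of indices
    and values gives a full-rank factorization. *)
Lemma mxrank_eq_fun (F : fieldType) n (S : finType) (s : 'I_n -> S) :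
  \rank (\matrix_(i, j) (s i == s j)%:R : 'M[F]_n) = #|s @: [set: 'I_n]|.
Proof.
set T := s @: [set: 'I_n].
have rep (k : 'I_#|T|) : {i | s i == enum_val k}.
  apply: sigW; have /imsetP[i _ ->] := enum_valP k.
  by exists i.
pose A : 'M[F]_(n, #|T|) := \matrix_(i, k) (s i == enum_val k)%:R.
pose E : 'M[F]_(#|T|, n) := \matrix_(k, i) (i == sval (rep k))%:R.
have EA : E *m A = 1%:M.
  apply/matrixP => k l; rewrite !mxE (bigD1 (sval (rep k)))//= big1 ?addr0.
    by rewrite !mxE eqxx mul1r (eqP (svalP (rep k))) (inj_eq enum_val_inj).
  by move=> i /negPf ne; rewrite !mxE ne mul0r.
rewrite -(@mxrank_factor _ _ _ A A^T E E^T)//; last by rewrite -trmx_mul EA trmx1.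
congr (\rank _); apply/matrixP => i j; rewrite !mxE.
have si : s i \in T by apply: imset_f.
rewrite (bigD1 (enum_rank_in si (s i)))//= big1 ?addr0.
  by rewrite !mxE !enum_rankK_in // eqxx mul1r eq_sym.
move=> k ne; rewrite !mxE; case: eqP => [e|_]; last by rewrite mul0r.
by case/eqP: ne; apply: enum_val_inj; rewrite -e (enum_rankK_in si si).
Qed.

Lemma mxrank_diag (F : fieldType) n (D : 'M[F]_n) :
  is_diag_mx D -> \rank D = #|[set i | D i i != 0]|.
Proof.
move=> /is_diag_mxP Dd; set T := [set i | D i i != 0].
pose A : 'M[F]_(n, #|T|) := \matrix_(i, k) (i == enum_val k)%:R.
pose B : 'M[F]_(#|T|, n) := \matrix_(k, i) (D i i * (i == enum_val k)%:R).
pose G : 'M[F]_(n, #|T|) := \matrix_(i, k) ((D i i)^-1 * (i == enum_val k)%:R).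
rewrite -(@mxrank_factor _ _ _ A B A^T G).
- congr (\rank _); apply/matrixP => i j; rewrite !mxE.
  have [iT|] := boolP (i \in T); last first.
    rewrite inE negbK => /eqP Di0; rewrite big1.
      by have [<-|/Dd->] := eqVneq i j.
    move=> k _; rewrite !mxE; case: eqP => [e|_]; last by rewrite mul0r.
    by have := enum_valP k; rewrite -e inE Di0 eqxx.
  rewrite (bigD1 (enum_rank_in iT i))//= big1 ?addr0.
    rewrite !mxE !enum_rankK_in // eqxx mul1r.
    by have [->|ne] := eqVneq j i; rewrite ?mulr1// mulr0 Dd // eq_sym.
  move=> k ne; rewrite !mxE; case: eqP => [e|_]; last by rewrite mul0r.
  by case/eqP: ne; apply: enum_val_inj; rewrite -e (enum_rankK_in iT iT).
- apply/matrixP => k l; rewrite !mxE (bigD1 (enum_val k))//= big1 ?addr0.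
    by rewrite !mxE eqxx mul1r (inj_eq enum_val_inj).
  by move=> i /negPf ne; rewrite !mxE ne mul0r.
- apply/matrixP => k l; rewrite !mxE (bigD1 (enum_val k))//= big1 ?addr0.
    rewrite !mxE eqxx mulr1 (inj_eq enum_val_inj) mulrA mulfV ?mul1r//.
    by have := enum_valP k; rewrite inE.
  by move=> i /negPf ne; rewrite !mxE ne mulr0 mul0r.
Qed.

Lemma unimodular_inverse (A : comUnitRingType) n (P : 'M[A]_n) :
  \det P \is a GRing.unit ->
  exists P', P *m P' = 1%:M /\ P' *m P = 1%:M.
Proof.
by move=> uP; exists (invmx P); split; [apply: mulmxV | apply: mulVmx].
Qed.

Lemma mxrank_diag_form (A : comUnitRingType) (F : fieldType)
    (f : {rmorphism A -> F}) n (P V Q : 'M[A]_n) :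
  \det P \is a GRing.unit -> \det Q \is a GRing.unit ->
  is_diag_mx (P *m V *m Q) ->
  #|[set i | f ((P *m V *m Q) i i) != 0]| = \rank (map_mx f V).
Proof.
move=> uP uQ /is_diag_mxP dD.
have -> : \rank (map_mx f V) = \rank (map_mx f (P *m V *m Q)).
  rewrite !map_mxM mxrankMfree; last first.
    by rewrite row_free_unit unitmxE det_map_mx rmorph_unit.
  rewrite eqmxMfull// row_full_unit unitmxE det_map_mx rmorph_unit//.
rewrite mxrank_diag; last first.
  by apply/is_diag_mxP => i j ij; rewrite mxE dD ?rmorph0.
by apply: eq_card => i; rewrite !inE [in RHS]mxE.
Qed.

(** A generalized inverse of [V] passes to [D]: with [Y = Q^-1 X P^-1] one has [D Y D = c D]. As [D]
    is diagonal, entry [(i, i)] reads [D_ii Y_ii D_ii = c D_ii], and [D_ii] cancels. *)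
Lemma diag_form_dvd (A : idomainType) n (P V Q X : 'M[A]_n) (c : A) i :
  \det P \is a GRing.unit -> \det Q \is a GRing.unit ->
  is_diag_mx (P *m V *m Q) -> V *m X *m V = c *: V ->
  (P *m V *m Q) i i != 0 -> exists y, (P *m V *m Q) i i * y = c.
Proof.
move=> uP uQ /is_diag_mxP dD VXV nz.
have [P' [PP' P'P]] := unimodular_inverse uP.
have [Q' [QQ' Q'Q]] := unimodular_inverse uQ.
set D := P *m V *m Q in dD nz *.
pose Y := Q' *m X *m P'.
have DYD : D *m Y *m D = c *: D.
  have -> : D *m Y *m D = P *m (V *m (Q *m Q') *m X *m (P' *m P) *m V) *m Q.
    by rewrite /D /Y !mulmxA.
  by rewrite QQ' P'P !mulmx1 VXV -scalemxAr -scalemxAl.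
clearbody D Y; exists (Y i i); apply: (mulIf nz).
have := congr1 (fun M : 'M[A]_n => M i i) DYD; rewrite [RHS]mxE => <-.
rewrite !mxE (bigD1 i)//= big1 ?addr0; last first.
  by move=> k ki; rewrite (dD k i) ?mulr0.
rewrite !mxE (bigD1 i)//= big1 ?addr0//.
by move=> k ki; rewrite (dD i k) ?mul0r// eq_sym.
Qed.

(** * Weighted cubes *)

Lemma neq_set_mem (I : finType) (S T : {set I}) :
  S != T -> exists e, (e \in S) != (e \in T).
Proof.
move=> neST; apply/existsP; apply: contraNT neST; rewrite negb_exists => /forallP H.
by apply/eqP/setP => e; have := H e; rewrite negbK => /eqP.
Qed.

(** Sign vectors are encoded by their sets of positive elements; this is then the Varchenko
    entry. *)
Definition cubew (A : comNzRingType) (I : finType) (x : I -> A)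
    (S T : {set I}) : A :=
  \prod_(e | (e \in S) != (e \in T)) x e.

Lemma cubew_mkcond (A : comNzRingType) (I : finType) (x : I -> A) S T :
  cubew x S T = \prod_e (if (e \in S) != (e \in T) then x e else 1).
Proof. by rewrite /cubew big_mkcond. Qed.

(** The tensor power over [L] of [((1, x), (x, 1)) ((1, -x), (-x, 1)) = (1 - x^2) I]. *)
Lemma cubew_inverse (A : comNzRingType) (I : finType) (L : {set I})
    (x : I -> A) (S T : {set I}) :
  S \subset L -> T \subset L ->
  \sum_(K : {set I} | K \subset L) cubew x S K * cubew (fun e => - x e) K T
    = (S == T)%:R * \prod_(e in L) (1 - x e ^+ 2).
Proof.
move=> SL TL.
(* [F e] and [G e] are the factors at [e] of the summand of [K], for [e] inside and outside [K].
   Expanding the product of the sums [F e + G e] gives the sum over all [K], and [F e = 0] off [L]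
   leaves only those contained in [L]. *)
pose F e := if e \in L then (if e \in S then 1 else x e)
                          * (if e \in T then 1 else - x e) else 0.
pose G e := (if e \in S then x e else 1) * (if e \in T then - x e else 1).
transitivity (\prod_e (F e + G e)).
  rewrite bigA_distr big_mkcond /=; apply: eq_big => // K _.
  case: ifPn => [KL|/fintype.subsetPn[e eK eL]]; last first.
    by rewrite (bigD1 e)//= eK /F (negPf eL) mul0r.
  rewrite !cubew_mkcond -big_split/=; apply: eq_bigr => e _.
  rewrite /F /G; have [eK|eK] := boolP (e \in K).
    by rewrite (fintype.subsetP KL)//; case: (e \in S); case: (e \in T).
  by case: (e \in S); case: (e \in T).
have [eST|neST] := eqVneq S T.
  rewrite mul1r [RHS]big_mkcond/=; apply: eq_bigr => e _; rewrite /F /G -eST.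
  have := fintype.subsetP SL e.
  by case: (e \in S) => [/(_ isT) ->|_]; last case: (e \in L); rewrite /=; ring.
rewrite mul0r; have [e ne] := neq_set_mem neST.
have eL : e \in L.
  move: ne; case: (boolP (e \in S)) => [/(fintype.subsetP SL)//|_].
  by case: (boolP (e \in T)) => [/(fintype.subsetP TL)|].
rewrite (bigD1 e)//= /F /G eL; move: ne.
by case: (e \in S); case: (e \in T) => //= _;
  rewrite mul1r mulr1 ?addNr ?subrr mul0r.
Qed.

(** Several regions may have the same trace, so [s] need not be injective; the indicator keeps one
    index per value. *)
Lemma sum_representatives (A : comNzRingType) n (K : finType) (s : 'I_n -> K)
    (T : pred K) (F : K -> A) :
  (forall i, T (s i)) -> (forall k, T k -> exists i, s i = k) ->
  \sum_i ([pick j | s j == s i] == Some i)%:R * F (s i) = \sum_(k | T k) F k.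
Proof.
move=> sT Ts; rewrite (partition_big s T)//=; apply: eq_bigr => k Tk.
have [i0 <-] := Ts _ Tk.
case pr: [pick j | s j == s i0] => [r|]; last first.
  by move: pr; case: pickP => // /(_ i0); rewrite eqxx.
have /eqP sr : s r == s i0 by move: pr; case: pickP => // j sj [<-].
rewrite (bigD1 r) ?sr//= pr eqxx mul1r big1 ?addr0//.
move=> i /andP[/eqP -> ne]; rewrite pr; case: eqP => [[e]|_]; last by rewrite mul0r.
by rewrite e eqxx in ne.
Qed.

(** Schur complement: deleting the vertices [U] from the cube replaces its scaled inverse [G] by
    [G - G_U (G_UU)^-1 G^U]. The last hypothesis makes [G_UU] the identity, so no division occurs.
    Since rows may be repeated, this only yields a generalized inverse, supported on one
    representative of each value of [s]. *)
Lemma cubew_ginverse (A : comNzRingType) (I : finType) (L : {set I})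
    (x : I -> A) (U : {set {set I}}) n (s : 'I_n -> {set I}) :
  (forall i, (s i \subset L) && (s i \notin U)) ->
  (forall K : {set I}, (K \subset L) && (K \notin U) -> exists i, s i = K) ->
  (forall K, K \in U -> K \subset L) ->
  {in U &, forall S T, cubew (fun e => - x e) S T = (S == T)%:R} ->
  exists X, (\matrix_(i, j) cubew x (s i) (s j)) *m X
            *m (\matrix_(i, j) cubew x (s i) (s j))
    = \prod_(e in L) (1 - x e ^+ 2) *: (\matrix_(i, j) cubew x (s i) (s j)).
Proof.
move=> sT Ts UL oU; set H := cubew x; set G := cubew (fun e => - x e) in oU.
set c := \prod_(e in L) _.
pose Z (K M : {set I}) := G K M - \sum_(S in U) G K S * G S M.
pose rep i : bool := [pick j | s j == s i] == Some i.
exists (\matrix_(j, k) ((rep j)%:R * (rep k)%:R * Z (s j) (s k))).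
have HZ (S M : {set I}) : (S \subset L) && (S \notin U) ->
    (M \subset L) && (M \notin U) ->
    \sum_(K : {set I} | (K \subset L) && (K \notin U)) H S K * Z K M
      = (S == M)%:R * c.
  move=> /andP[SL SU] /andP[ML MU].
  (* The rows of [Z] indexed by [U] vanish because [G] is the identity there, so the sum may run
     over the whole cube, where [H] and [G] are inverse up to [c]. *)
  transitivity (\sum_(K : {set I} | K \subset L) H S K * Z K M).
    rewrite [RHS](bigID (fun K => K \in U))/= [X in _ = X + _]big1 ?add0r//.
    move=> K /andP[KL KU].
    rewrite /Z (bigD1 K)//= (oU K K)// eqxx mul1r big1 ?addr0 ?subrr ?mulr0//.
    by move=> K' /andP[K'U ne]; rewrite (oU K K')// eq_sym (negPf ne) mul0r.
  under eq_bigr do rewrite mulrBr mulr_sumr.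
  rewrite sumrB exchange_big/= [X in _ - X]big1 ?subr0 ?cubew_inverse//.
  move=> K KU; under eq_bigr do rewrite mulrA.
  rewrite -mulr_suml cubew_inverse ?(UL K)//.
  by case: eqP => [eSK|_]; [rewrite eSK KU in SU | rewrite !mul0r].
apply/matrixP => i l; rewrite !mxE.
transitivity (\sum_k (rep k)%:R *
   ((\sum_j (rep j)%:R * (H (s i) (s j) * Z (s j) (s k))) * H (s k) (s l))).
  apply: eq_bigr => k _; rewrite !mxE mulrA; congr (_ * _).
  rewrite mulr_sumr; apply: eq_bigr => j _; rewrite !mxE.
  by ring.
pose T (K : {set I}) := (K \subset L) && (K \notin U).
have SR (F : {set I} -> A) :
    \sum_i (rep i)%:R * F (s i) = \sum_(K : {set I} | T K) F K.
  exact: (@sum_representatives _ _ _ s T F).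
have SRZ M : \sum_j (rep j)%:R * (H (s i) (s j) * Z (s j) M)
    = \sum_(K : {set I} | T K) H (s i) K * Z K M.
  exact: (SR (fun K => H (s i) K * Z K M)).
under eq_bigr do rewrite SRZ.
rewrite (SR (fun M => (\sum_(K : {set I} | T K) H (s i) K * Z K M)
                      * H M (s l))).
rewrite (bigD1 (s i)) ?/(T _)//= HZ// eqxx mul1r big1 ?addr0//.
by move=> M /andP[MT ne]; rewrite HZ// eq_sym (negPf ne) !mul0r.
Qed.

(** Only the subsets [J] of [B :\: K] contribute, and their signs cancel unless this difference is
    empty. *)
Lemma sum_sign_disjoint (I : finType) (B K : {set I}) : K \subset B ->
  \sum_(J : {set I} | J \subset B) (-1) ^+ #|J| * (K :&: J == finset.set0)%:R
    = (K == B)%:R :> int.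
Proof.
move=> KB.
pose F e : int := if (e \in B) && (e \notin K) then -1 else 0.
transitivity (\prod_e (F e + 1)).
  rewrite bigA_distr big_mkcond/=; apply: eq_bigr => J _.
  case: ifPn => [JB|/fintype.subsetPn[e eJ eB]]; last first.
    by rewrite (bigD1 e)//= eJ /F (negPf eB) mul0r.
  have [KJ0|[e]] := set_0Vmem (K :&: J); last first.
    move=> eKJ; have /finset.setIP[eK eJ] := eKJ.
    rewrite (bigD1 e)//= eJ /F eK andbF mul0r.
    by case: eqP => [e0|_]; [rewrite e0 finset.inE in eKJ | rewrite mulr0].
  rewrite KJ0 eqxx mulr1 -big_mkcond/= -prodr_const; apply: eq_bigr => e eJ.
  rewrite /F (fintype.subsetP JB)//=; case: ifPn => //; rewrite negbK => eK.
  by have := finset.in_set0 e; rewrite -KJ0 finset.inE eK eJ.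
have [eKB|neKB] := eqVneq K B.
  by rewrite big1// => e _; rewrite /F eKB andbN add0r.
have /properP[_ [e eB eK]] : K \proper B by rewrite finset.properEneq neKB.
by rewrite (bigD1 e)//= /F eB eK addNr mul0r.
Qed.

(** * Integer polynomials *)

Local Notation mpolyZ N := (mpoly.mpoly N int).
Local Notation Xv e := (mpoly.mpolyX int (mpoly.mnm1 e)).

Definition peval N (K : comNzRingType) (v : 'I_N -> K) :
  {rmorphism mpolyZ N -> K} := mpoly.mmap (intr : int -> K) v.

Lemma pevalX N (K : comNzRingType) (v : 'I_N -> K) e : peval v (Xv e) = v e.
Proof. by rewrite /= mpoly.mmapX mpoly.mmap1U. Qed.

Lemma mpolyZ_ring_ind N (T : mpolyZ N -> Prop) :
  (forall c : int, T c%:~R) -> (forall e, T (Xv e)) ->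
  (forall p q, T p -> T q -> T (p + q)) ->
  (forall p q, T p -> T q -> T (p * q)) -> forall p, T p.
Proof.
move=> TC TX TD TM p; rewrite (mpoly.mpolyE p).
elim/big_ind: _ => //; first exact: (TC 0).
move=> m _; rewrite -mpoly.mul_mpolyC; apply: (TM).
  have -> : mpoly.mpolyC N (mpoly.mcoeff m p)
    = (mpoly.mcoeff m p)%:~R by rewrite -(rmorph_int (@mpoly.mpolyC N int)) intz.
  exact: TC.
rewrite mpoly.mpolyXE_id; elim/big_ind: _ => [|p1 q1|e _]; [exact: (TC 1)|exact: (TM)|].
elim: (mpoly.fun_of_multinom m e) => [|k IH]; first exact: (TC 1).
by rewrite exprS; apply: (TM).
Qed.

Lemma mpolyZ_rmorph_ext N (K : comNzRingType) (f g : {rmorphism mpolyZ N -> K}) :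
  (forall e, f (Xv e) = g (Xv e)) -> f =1 g.
Proof.
move=> fg; elim/mpolyZ_ring_ind => [c|//|p q fp fq|p q fp fq].
- by rewrite !rmorph_int.
- by rewrite !rmorphD fp fq.
- by rewrite !rmorphM fp fq.
Qed.

Definition set_var1 N (e : 'I_N) : {rmorphism mpolyZ N -> mpolyZ N} :=
  peval (fun i => if i == e then 1 else Xv i).

(** The factor theorem at [x_e = 1]: the kernel of the substitution is generated by [1 - Xv e]. *)
Lemma set_var1_dvd N (e : 'I_N) p :
  exists q, p = set_var1 e p + (1 - Xv e) * q.
Proof.
elim/mpolyZ_ring_ind: p => [c|i|p q [p' pE] [q' qE]|p q [p' pE] [q' qE]].
- by exists 0; rewrite rmorph_int mulr0 addr0.
- rewrite /set_var1 pevalX; case: eqP => [->|_]; last by exists 0; rewrite mulr0 addr0.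
  by exists (-1); rewrite mulrN1 opprB addrC subrK.
- by exists (p' + q'); rewrite rmorphD {1}pE {1}qE addrACA -mulrDr.
- exists (p' * q + set_var1 e p * q').
  rewrite rmorphM mulrDr mulrA [_ * (set_var1 e p * q')]mulrCA addrCA -mulrDr -qE.
  by rewrite addrC -mulrDl -pE.
Qed.

Lemma set_var1_neq0 N (e : 'I_N) (v : 'I_N -> rat) p :
  v e = 1 -> peval v p != 0 -> set_var1 e p != 0.
Proof.
move=> ve; apply: contraNneq => p0.
rewrite -[_ == 0]/(peval v p == 0).
have <- : (peval v \o set_var1 e) p = peval v p.
  apply: (@mpolyZ_rmorph_ext N rat (peval v \o set_var1 e) (peval v)) => i /=.
  rewrite /set_var1 !pevalX; case: eqP => [->|_]; last by rewrite pevalX.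
  by rewrite rmorph1 ve.
by rewrite /= p0 rmorph0.
Qed.

(** Generating the kernel of a map to a domain, [u] is prime: as it does not divide [d], it divides
    [y]. *)
Lemma cancel_prime_factor (A : idomainType) (f : {rmorphism A -> A}) (u d y R : A) :
  (forall p, f p = 0 -> exists q, p = u * q) -> f u = 0 -> u != 0 ->
  f d != 0 -> d * y = u * R -> exists q, d * q = R.
Proof.
move=> f0 fu u0 fd dy.
have /eqP : f d * f y = 0 by rewrite -rmorphM dy rmorphM fu mul0r.
rewrite mulf_eq0 (negPf fd) => /eqP/f0[q yE].
by exists q; apply: (mulfI u0); rewrite -dy yE mulrCA.
Qed.

Lemma strip_factors N (d y R : mpolyZ N) (r : seq 'I_N) :
  d * y = \prod_(e <- r) (1 - Xv e) * R ->
  (forall e, e \in r -> set_var1 e d != 0) ->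
  exists y', d * y' = R.
Proof.
elim: r y => [|e r IH] y; first by rewrite big_nil mul1r => <- _; exists y.
rewrite big_cons -mulrA => dy dr.
have [] := @cancel_prime_factor _ (set_var1 e) _ _ _ _ _ _ _ _ dy.
- by move=> p p0; have [q] := set_var1_dvd e p; rewrite p0 add0r => ->; exists q.
- by rewrite rmorphB rmorph1 /set_var1 pevalX eqxx subrr.
- apply/eqP => /(congr1 (peval (fun=> 0 : rat))).
  by rewrite rmorphB rmorph1 pevalX rmorph0 subr0 => /eqP; rewrite oner_eq0.
- exact: (dr _ (mem_head _ _)).
- move=> q dq; apply: (IH q dq) => i ir.
  by apply: dr; rewrite inE ir orbT.
Qed.

Definition ipoint N (J : {set 'I_N}) (e : 'I_N) : rat := (e \in J)%:R.

(** Of all the factors [1 - x_e] and [1 + x_e], only the [1 - x_e] with [e] in [K] vanish at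
    [ipoint K]. None of these divides [d], so [d] divides the product [R] of the others. *)
Lemma dvd_prod_eval N (d y : mpolyZ N) (S K : {set 'I_N}) : K \subset S ->
  d * y = \prod_(e in S) (1 - Xv e ^+ 2) ->
  (forall e, e \in K -> set_var1 e d != 0) ->
  peval (ipoint K) d != 0.
Proof.
move=> KS dy dK.
pose R : mpolyZ N := \prod_(e in K) (1 + Xv e) * \prod_(e in S :\: K) (1 - Xv e ^+ 2).
have [y' dR] : exists y', d * y' = R.
  apply: (@strip_factors _ d y R (enum K)).
    rewrite dy big_enum/= /R mulrA -big_split/=.
    rewrite (big_setID K)/= (finset.setIidPr KS); congr (_ * _).
    by apply: eq_bigr => e _; rewrite -subr_sqr expr1n.
  by move=> e; rewrite mem_enum; apply: dK.
have : peval (ipoint K) R != 0.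
  rewrite rmorphM !rmorph_prod mulf_neq0//.
    apply/prodf_neq0 => e eK.
    by rewrite rmorphD rmorph1 pevalX /ipoint eK.
  apply/prodf_neq0 => e /finset.setDP[_ /negPf eK].
  by rewrite rmorphB rmorph1 rmorphXn /= pevalX /ipoint eK expr0n subr0.
by rewrite -dR rmorphM mulf_eq0 negb_or => /andP[].
Qed.

(** Vanishing at [ipoint J] is caused by a factor [1 - x_j] of [d] with [j] in [J], and such a
    factor already vanishes at [ipoint [set j]]. *)
Lemma dvd_prod_evalP N (d y : mpolyZ N) (S J : {set 'I_N}) : J \subset S ->
  d * y = \prod_(e in S) (1 - Xv e ^+ 2) ->
  reflect (forall j, j \in J -> peval (ipoint [set j]) d != 0)
          (peval (ipoint J) d != 0).
Proof.
move=> JS dy; apply: (iffP idP) => [dJ j jJ|dJ].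
  apply: (dvd_prod_eval _ dy).
    by rewrite finset.sub1set (fintype.subsetP JS).
  move=> e /finset.set1P ->; apply: (set_var1_neq0 _ dJ).
  by rewrite /ipoint jJ.
apply: (dvd_prod_eval JS dy) => e eJ.
by apply: (set_var1_neq0 _ (dJ _ eJ)); rewrite /ipoint finset.inE eqxx.
Qed.

(** * The cube minus two opposite vertices *)

Section CircuitMatrix.
Variables (N n : nat) (B C : {set 'I_N}) (t : 'I_n -> {set 'I_N}).
Hypothesis B3 : (2 < #|B|)%N.
Hypothesis CB : C \subset B.
Hypothesis tU : forall i, (t i :&: B != C) && (t i :&: B != B :\: C).
Hypothesis tT : forall K : {set 'I_N}, K \subset B -> K != C -> K != B :\: C ->
  exists i, t i :&: B = K.

Local Notation X := (fun e : 'I_N => Xv e : mpolyZ N).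
Let V : 'M[mpolyZ N]_n := \matrix_(i, j) cubew X (t i) (t j).

Lemma compl_neq : C != B :\: C.
Proof.
have [b bB] : exists b, b \in B.
  by apply/set0Pn; rewrite -card_gt0 (leq_trans _ B3).
apply/eqP => /setP/(_ b); rewrite finset.inE bB andbT.
by case: (b \in C).
Qed.

Lemma compl_inter (J K : {set 'I_N}) : J != finset.set0 -> K \subset B :\: J ->
  J \subset B -> exists i, t i :&: (B :\: J) = K.
Proof.
move=> /set0Pn[j jJ] KBJ JB; have jB := fintype.subsetP JB _ jJ.
have KB := fintype.subset_trans KBJ (finset.subsetDl B J).
have key (K' : {set 'I_N}) : K' \subset B -> K' :\: J = K -> K' != C ->
    K' != B :\: C -> exists i, t i :&: (B :\: J) = K.
  move=> K'B K'J ne1 ne2; have [i ti] := tT K'B ne1 ne2.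
  by exists i; rewrite -K'J -ti finset.setIDA.
have KJ : K :\: J = K.
  apply/finset.setDidPl; rewrite finset.disjoints_subset.
  by apply: fintype.subset_trans KBJ _; rewrite finset.setDE finset.subsetIr.
have jK : j \notin K.
  by apply/negP => /(fintype.subsetP KBJ); rewrite finset.inE jJ.
have KjJ : (j |: K) :\: J = K.
  rewrite finset.setDUl KJ; apply/finset.setUidPr/fintype.subsetP => x.
  by rewrite !finset.inE => /andP[nx /eqP xj]; rewrite xj jJ in nx.
have KjB : (j |: K) \subset B by rewrite finset.subUset finset.sub1set jB.
(* [K] and [j |: K] are neighbours in the cube, so at most one of them is a
   missing vertex. *)
have [KU|KnU] := boolP ((K == C) || (K == B :\: C)); last first.
  by move: KnU; rewrite negb_or => /andP[]; apply: key.
have cB : ~ (B \subset [set j]).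
  move/subset_leq_card; rewrite cards1 leqNgt => /negP; apply.
  exact: ltnW.
apply: (key (j |: K)) => //; apply/eqP => e; apply: cB; apply/fintype.subsetP => x xB.
  case/orP: KU => /eqP KE; have := congr1 (fun M : {set 'I_N} => x \in M) e;
    have := congr1 (fun M : {set 'I_N} => x \in M) KE.
    by have := congr1 (fun M : {set 'I_N} => j \in M) e;
      rewrite -KE !finset.inE eqxx/= (negPf jK).
  by rewrite !finset.inE xB; case: (x \in C); case: (x \in K); case: (x == j).
case/orP: KU => /eqP KE; have := congr1 (fun M : {set 'I_N} => x \in M) e;
    have := congr1 (fun M : {set 'I_N} => x \in M) KE.
  by rewrite !finset.inE xB; case: (x \in C); case: (x \in K); case: (x == j).
by have := congr1 (fun M : {set 'I_N} => j \in M) e;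
  rewrite -KE !finset.inE eqxx/= (negPf jK).
Qed.

Let U (J : {set 'I_N}) : {set {set 'I_N}} :=
  if J == finset.set0 then [set C; B :\: C] else finset.set0.

Lemma trace_sub (J : {set 'I_N}) i :
  (t i :&: (B :\: J) \subset B :\: J) && (t i :&: (B :\: J) \notin U J).
Proof.
rewrite finset.subsetIr /= /U; case: eqP => [->|_]; last by rewrite finset.inE.
by rewrite finset.setD0 !finset.inE negb_or; apply: tU.
Qed.

Lemma trace_onto (J K : {set 'I_N}) : J \subset B ->
  (K \subset B :\: J) && (K \notin U J) -> exists i, t i :&: (B :\: J) = K.
Proof.
move=> JB /andP[KBJ]; rewrite /U; case: eqP => [J0|/eqP J0 _]; last first.
  exact: compl_inter.
rewrite !finset.inE negb_or => /andP[n1 n2].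
by move: KBJ; rewrite J0 finset.setD0 => KB; apply: tT.
Qed.

Lemma card_trace (J : {set 'I_N}) : J \subset B ->
  #|(fun i => t i :&: (B :\: J)) @: [set: 'I_n]|%:Z
   = #|[set K : {set 'I_N} | (K \subset B) && (K :&: J == finset.set0)]|%:Z
     - 2 * (J == finset.set0)%:R.
Proof.
move=> JB.
have -> : (fun i => t i :&: (B :\: J)) @: [set: 'I_n]
    = [set K : {set 'I_N} | (K \subset B) && (K :&: J == finset.set0)] :\: U J.
  apply/setP => K; rewrite !finset.inE finset.setI_eq0 -finset.subsetD andbC.
  apply/imsetP/idP => [[i _ ->]|/(trace_onto JB)[i <-]]; last by exists i.
  exact: trace_sub.
rewrite cardsD; set T := [set K | _].
have [J0|J0] := eqVneq J finset.set0; last first.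
  by rewrite /U (negPf J0) finset.setI0 cards0 subn0 mulr0 subr0.
have UT : U J \subset T.
  rewrite /U J0 eqxx; apply/fintype.subsetP => K.
  rewrite !finset.inE J0 finset.setI0 eqxx andbT.
  by case/orP => /eqP ->; rewrite ?CB// finset.subsetDl.
have U2 : #|U J| = 2 by rewrite /U J0 eqxx cards2 compl_neq.
rewrite (finset.setIidPr UT) U2 mulr1 -subzn//.
by rewrite -U2 subset_leq_card.
Qed.

(** * Vanishing of the diagonal entries at 0/1 points *)

Section DiagonalForm.
Variables P Q : 'M[mpolyZ N]_n.
Hypotheses (uP : \det P \is a GRing.unit) (uQ : \det Q \is a GRing.unit).
Hypothesis dD : is_diag_mx (P *m V *m Q).
Let D := P *m V *m Q.

Definition circuit_point (J : {set 'I_N}) (e : 'I_N) : rat :=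
  if e \in B then (e \in J)%:R else 1.

Let nz i (J : {set 'I_N}) := peval (circuit_point J) (D i i) != 0.

Lemma card_nz (J : {set 'I_N}) : J \subset B ->
  #|[set i | nz i J]|%:Z
   = #|[set K : {set 'I_N} | (K \subset B) && (K :&: J == finset.set0)]|%:Z
     - 2 * (J == finset.set0)%:R.
Proof.
move=> JB; rewrite -card_trace// -(mxrank_eq_fun rat) /nz /D.
rewrite (mxrank_diag_form _ uP uQ dD); congr (\rank _)%:Z.
apply/matrixP => i j; rewrite !mxE rmorph_prod.
set s := fun i => t i :&: (B :\: J); rewrite -/(s i) -/(s j).
have [sij|/neq_set_mem[e]] := eqVneq (s i) (s j).
  apply: big1 => e; rewrite pevalX /circuit_point.
  have := congr1 (fun M : {set 'I_N} => e \in M) sij; rewrite !finset.inE.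
  case: (e \in B) => //; case: (e \in J) => //; rewrite !andbT => ->.
  by rewrite eqxx.
rewrite !finset.inE; have [eJ|eJ] := boolP (e \in J); first by rewrite !andbF.
have [eB|eB] := boolP (e \in B); last by rewrite !andbF.
rewrite !andbT => ne.
by rewrite (bigD1 e)//= -/(peval _ _) pevalX /circuit_point eB (negPf eJ) mul0r.
Qed.

(** Restriction to the face with vertices [circuit_point (J :|: K)], [K \subset L]: the variables of
    [L] stay free. *)
Definition face_subst (J L : {set 'I_N}) (e : 'I_N) : mpolyZ N :=
  if e \in B then (if e \in J then 1 else if e \in L then Xv e else 0) else 1.

(** The third hypothesis asks that some variable of [B] be specialized. If [J] is nonempty, no trace
    is missing and [U J] is empty; if [J] is empty, some variable of [B] becomes 0 and kills the
    off-diagonal entry of the block on [U J]. *)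
Lemma face_subst_dvd (J L : {set 'I_N}) i : J \subset B -> L \subset B :\: J ->
  (J != finset.set0) || (L != B) -> peval (face_subst J L) (D i i) != 0 ->
  exists y, peval (face_subst J L) (D i i) * y = \prod_(e in L) (1 - Xv e ^+ 2).
Proof.
move=> JB LBJ JL; set f := peval (face_subst J L).
pose x e : mpolyZ N := if e \in L then Xv e else 0.
pose s i := t i :&: (B :\: J).
have VE : map_mx f V = \matrix_(i, j) cubew x (s i) (s j).
  apply/matrixP => k l; rewrite !mxE rmorph_prod cubew_mkcond big_mkcond.
  apply: eq_bigr => e _; rewrite /s /x !finset.inE /f pevalX /face_subst.
  case: (e \in B); last by rewrite !andbF; case: ifP.
  by case: (e \in J); rewrite ?andbF ?andbT//=; case: ifP.
have UL K : K \in U J -> K \subset B :\: J.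
  rewrite /U; case: eqP => [->|_]; last by rewrite finset.inE.
  rewrite finset.setD0 !finset.inE => /orP[]/eqP -> //.
  exact: finset.subsetDl.
have cubew_self K : cubew (fun e => - x e) K K = 1.
  by rewrite cubew_mkcond big1// => e _; rewrite eqxx.
have cubew_symm K M : cubew (fun e => - x e) K M = cubew (fun e => - x e) M K.
  by rewrite /cubew; apply: eq_bigl => e; rewrite eq_sym.
have oU : {in U J &, forall S T, cubew (fun e => - x e) S T = (S == T)%:R}.
  have [J0|J0] := eqVneq J finset.set0; last first.
    by move=> S T; rewrite /U (negPf J0) finset.inE.
  have LB : L \proper B.
    rewrite finset.properEneq; move: JL; rewrite J0 eqxx /= => -> /=.
    by move: LBJ; rewrite J0 finset.setD0.
  have /fintype.properP[_ [e eB eL]] := LB.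
  have opp0 : cubew (fun e => - x e) C (B :\: C) = 0.
    rewrite cubew_mkcond (bigD1 e)//= finset.inE eB andbT /x (negPf eL) oppr0.
    by case: (e \in C); rewrite /= mul0r.
  move=> S T; rewrite /U J0 eqxx !finset.inE.
  case/orP => /eqP -> /orP[] /eqP ->; rewrite ?cubew_self ?eqxx ?(negPf compl_neq)//.
  by rewrite cubew_symm opp0 eq_sym (negPf compl_neq).
have [Y YE] := cubew_ginverse (trace_sub J) (fun K => @trace_onto J K JB) UL oU.
rewrite -VE in YE.
have cE : \prod_(e in B :\: J) (1 - x e ^+ 2) = \prod_(e in L) (1 - Xv e ^+ 2).
  rewrite (big_setID L)/= (finset.setIidPr LBJ) [X in _ * X]big1 ?mulr1.
    by apply: eq_bigr => e eL; rewrite /x eL.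
  by move=> e /finset.setDP[_ /negPf eL]; rewrite /x eL expr0n subr0.
rewrite cE in YE.
have DE : f (D i i) = (map_mx f P *m map_mx f V *m map_mx f Q) i i.
  by rewrite -!map_mxM [RHS]mxE.
rewrite DE; apply: diag_form_dvd YE.
- by rewrite det_map_mx rmorph_unit.
- by rewrite det_map_mx rmorph_unit.
- apply/is_diag_mxP => k l kl; rewrite -!map_mxM mxE.
  by move/is_diag_mxP: dD => ->//; rewrite rmorph0.
Qed.

Lemma face_point (J L K : {set 'I_N}) p : L \subset B :\: J -> K \subset L ->
  peval (ipoint K) (peval (face_subst J L) p) = peval (circuit_point (J :|: K)) p.
Proof.
move=> LBJ KL.
apply: (@mpolyZ_rmorph_ext N rat (peval (ipoint K) \o peval (face_subst J L))).
move=> e; rewrite [LHS]/= -/(peval _) -[LHS]/(peval _ (peval _ _)) !pevalX.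
rewrite /face_subst /circuit_point finset.inE.
case: (e \in B); last by rewrite rmorph1.
case: (e \in J); first by rewrite rmorph1.
case: ifPn => [eL|eL]; first by rewrite pevalX.
rewrite rmorph0 /=; have [/(fintype.subsetP KL)|//] := boolP (e \in K).
by rewrite (negPf eL).
Qed.

(** Either [D i i] vanishes on the whole face, hence at all its vertices, or it divides a product of
    factors [1 - x_e ^+ 2]. That product is 1 at the vertex [J], so [nz i J] holds in the second
    case. *)
Lemma nz_face (J L : {set 'I_N}) i : J \subset B -> L \subset B :\: J ->
  (J != finset.set0) || (L != B) -> L != finset.set0 ->
  (nz i (J :|: L) -> nz i J) /\
  (nz i (J :|: L) <-> forall j, j \in L -> nz i (J :|: [set j])).
Proof.
move=> JB LBJ JL /set0Pn[l lL].
have [p0|] := eqVneq (peval (face_subst J L) (D i i)) 0.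
  have nz0 (K : {set 'I_N}) : K \subset L -> nz i (J :|: K) = false.
    by move=> KL; rewrite /nz -(face_point _ LBJ KL) p0 rmorph0 eqxx.
  split; first by rewrite nz0.
  split; first by rewrite nz0.
  by move/(_ l lL); rewrite nz0// finset.sub1set.
case/face_subst_dvd => // y dy.
have nzE (K : {set 'I_N}) : K \subset L -> nz i (J :|: K)
    = (peval (ipoint K) (peval (face_subst J L) (D i i)) != 0).
  by move=> KL; rewrite /nz -(face_point _ LBJ KL).
have nzP (K : {set 'I_N}) (KL : K \subset L) := dvd_prod_evalP KL dy.
split=> [_|].
  rewrite -[J]finset.setU0 nzE ?finset.sub0set//.
  by apply/nzP; rewrite ?finset.sub0set// => j; rewrite finset.inE.
rewrite nzE//; split => [/nzP dL j jL|dL].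
  by rewrite nzE ?finset.sub1set//; apply: dL.
apply/nzP => // j jL.
by have := dL j jL; rewrite nzE ?finset.sub1set.
Qed.

Lemma nz_proper (J : {set 'I_N}) i : J \subset B -> J != B ->
  nz i J <-> nz i finset.set0 /\ forall j, j \in J -> nz i [set j].
Proof.
move=> JB neJ; have [->|J0] := eqVneq J finset.set0.
  by split=> [?|[]//]; split => // j; rewrite finset.inE.
have JB0 : J \subset B :\: finset.set0 by rewrite finset.setD0.
have sB : finset.set0 \subset B by apply: finset.sub0set.
have := @nz_face finset.set0 J i sB JB0; rewrite neJ orbT finset.set0U.
case=> // n0 [n1 n2]; split=> [nJ|[_ nJ]].
  split; first exact: n0.
  by move=> j jJ; have := n1 nJ j jJ; rewrite finset.set0U.
by apply: n2 => j jJ; rewrite finset.set0U; apply: nJ.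
Qed.

(** The set [B] is not covered by the faces at the empty set. With [x_a = 1] fixed, the face spanned
    by [B :\ a] reduces it to the pairs [a], [j], and these are proper subsets of [B] because
    [2 < #|B|]. *)
Lemma nz_iff (J : {set 'I_N}) i : J \subset B ->
  nz i J <-> nz i finset.set0 /\ forall j, j \in J -> nz i [set j].
Proof.
move=> JB; have [JE|] := eqVneq J B; last exact: nz_proper.
have [a aB] : exists a, a \in B.
  by apply/set0Pn; rewrite -card_gt0 (leq_trans _ B3).
have pair j : j \in B -> j != a ->
    nz i ([set a] :|: [set j]) <->
    [/\ nz i finset.set0, nz i [set a] & nz i [set j]].
  move=> jB ja; have ne : [set a] :|: [set j] != B.
    apply: contraTneq (B3) => <-; rewrite cards2 -leqNgt.
    by case: (_ != _).
  have sB : [set a] :|: [set j] \subset B.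
    by rewrite finset.subUset !finset.sub1set aB.
  have [n1 n2] := nz_proper i sB ne; split=> [/n1[n0 nj]|[n0 na nj]].
    by split=> //; apply: nj; rewrite !finset.inE eqxx ?orbT.
  by apply: n2; split=> // k; rewrite !finset.inE => /orP[]/eqP ->.
have aB1 : [set a] \subset B by rewrite finset.sub1set.
have a0 : [set a] != finset.set0 by apply/set0Pn; exists a; rewrite finset.inE.
have L0 : B :\ a != finset.set0.
  rewrite -card_gt0; have := B3; rewrite (cardsD1 a B) aB add1n ltnS.
  exact: leq_trans.
have := @nz_face [set a] (B :\ a) i aB1 (fintype.subxx _).
rewrite a0 => /(_ isT L0)[_].
rewrite JE finset.setD1K// => nzB; rewrite nzB; split=> [H|[n0 nB] j].
  have /set0Pn[b bBa] := L0.
  have/finset.setD1P[ba bB] := bBa.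
  have [n0 na _] := (pair b bB ba).1 (H b bBa).
  split=> // j jB; have [->//|ja] := eqVneq j a.
  by have [] := (pair j jB ja).1; first by apply: H; rewrite !finset.inE ja.
case/finset.setD1P => ja jB; apply/(pair j jB ja); split=> //; exact: nB.
Qed.

Lemma diagonal_form_absurd : False.
Proof.
pose I := [set i | nz i finset.set0].
pose K i := [set j in B | ~~ nz i [set j]].
have KB i : K i \subset B by apply/fintype.subsetP => j; rewrite finset.inE => /andP[].
have nzK (J : {set 'I_N}) : J \subset B ->
    #|[set i | nz i J]|%:Z = \sum_(i in I) (K i :&: J == finset.set0)%:R.
  move=> JB; have -> : [set i | nz i J] = [set i in I | K i :&: J == finset.set0].
    apply/setP => i; rewrite !finset.inE.
    apply/idP/andP => [/(nz_iff i JB)[n0 nj]|[n0 /eqP K0]].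
      split=> //; apply/eqP/setP => j; rewrite !finset.inE.
      apply/negP => /andP[/andP[_ /negP nnj] /nj]//.
    apply/(nz_iff i JB); split=> // j jJ; apply: contraT => nnj.
    have := congr1 (fun M : {set 'I_N} => j \in M) K0.
    by rewrite !finset.inE (fintype.subsetP JB)// nnj jJ.
  by rewrite -sum1dep_card -natz natr_sum big_mkcondr; apply: eq_bigr => i _; case: eqP.
have lhs : \sum_(J : {set 'I_N} | J \subset B) (-1) ^+ #|J| * #|[set i | nz i J]|%:Z
    = \sum_(i in I) (K i == B)%:R.
  under eq_bigr => J JB do rewrite nzK// mulr_sumr.
  by rewrite exchange_big; apply: eq_bigr => i _; rewrite sum_sign_disjoint.
have rhs : \sum_(J : {set 'I_N} | J \subset B) (-1) ^+ #|J| * #|[set i | nz i J]|%:Z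
    = -1.
  under eq_bigr => J JB do rewrite card_nz// mulrBr.
  rewrite sumrB.
  (* The number of vertices of a cube is itself a sum of disjointness indicators, so the same
     alternating sum retains only [M = B]. *)
  have -> : \sum_(J : {set 'I_N} | J \subset B) (-1) ^+ #|J|
      * #|[set M : {set 'I_N} | (M \subset B) && (M :&: J == finset.set0)]|%:Z = 1.
    transitivity (\sum_(M : {set 'I_N} | M \subset B) (M == B)%:R : int).
      rewrite -(eq_bigr _ (fun M MB => @sum_sign_disjoint _ B M MB)) exchange_big.
      apply: eq_bigr => J JB; rewrite -mulr_sumr; congr (_ * _).
      by rewrite -sum1dep_card -natz natr_sum big_mkcondr; apply: eq_bigr => i _; case: eqP.
    by rewrite (bigD1 B)//= eqxx big1 ?addr0// => M /andP[_ /negPf ->].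
  rewrite (bigD1 finset.set0) ?finset.sub0set//= big1.
    by rewrite cards0 eqxx.
  by move=> J /andP[_ /negPf ->]; rewrite !mulr0.
have : 0 <= \sum_(i in I) (K i == B)%:R :> int by apply: sumr_ge0.
by rewrite -lhs rhs.
Qed.

End DiagonalForm.
End CircuitMatrix.

Theorem circuit_no_diagonal_form N n (B C : {set 'I_N}) (t : 'I_n -> {set 'I_N}) :
  (2 < #|B|)%N -> C \subset B ->
  (forall i, (t i :&: B != C) && (t i :&: B != B :\: C)) ->
  (forall K : {set 'I_N}, K \subset B -> K != C -> K != B :\: C ->
    exists i, t i :&: B = K) ->
  ~ has_diagonal_form (\matrix_(i, j) cubew (fun e => Xv e : mpolyZ N) (t i) (t j)).
Proof.
move=> B3 CB tU tT [P [Q [uP uQ dD]]].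
exact: (@diagonal_form_absurd N n B C t B3 CB tU tT P Q uP uQ dD).
Qed.

(** * Spheres and pseudospheres *)

Section ConnectedSets.
Local Open Scope classical_set_scope.

Lemma connected_clopen (T : topologicalType) (A P Q : set T) :
  connected A -> open P -> closed Q -> A `&` P = A `&` Q ->
  A `&` P !=set0 -> A `<=` P.
Proof.
move=> cA oP cQ PQ P0.
have AP : A `&` P = A by apply: cA => //; [exists P | exists Q].
by move=> x; rewrite -AP => -[].
Qed.

Lemma connected_join (T : topologicalType) (A : set T) :
  (forall x y, A x -> A y -> exists C, [/\ connected C, C `<=` A, C x & C y]) ->
  connected A.
Proof.
move=> H; have [->|/set0P[x0 Ax0]] := eqVneq A set0; first exact: connected0.
suff -> : A = connected_component A x0 by apply: component_connected.
apply/seteqP; split; last exact: connected_component_sub.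
by move=> y Ay; have [C [cC CA Cx Cy]] := H _ _ Ax0 Ay; exists C.
Qed.

Lemma within_continuous_nbhs (T U : topologicalType) (A : set T) (f : T -> U) x W :
  {within A, continuous f} -> A x -> nbhs (f x) W ->
  nbhs x [set y | A y -> W (f y)].
Proof. by move=> /subspace_continuousP cf Ax /(cf x Ax). Qed.

Lemma within_continuous_closed (T U : topologicalType) (A : set T) (f : T -> U) C :
  {within A, continuous f} -> closed A -> closed C -> closed (A `&` f @^-1` C).
Proof.
move=> /continuous_closedP cf cA cC.
have /closed_subspaceP[V cV VE] := cf _ cC.
by rewrite setIC -VE; apply: closedI.
Qed.

End ConnectedSets.

(** * Caps of the round sphere *)

Section SphereGeometry.
Variables (R : realType) (k : nat).
Local Open Scope classical_set_scope.
Implicit Types (x y p q : 'rV[R]_k.+1) (c : R).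

Definition dotp x y : R := \sum_i x 0 i * y 0 i.

Lemma dotpDl x y p : dotp (x + y) p = dotp x p + dotp y p.
Proof. by rewrite /dotp -big_split; apply: eq_bigr => i _; rewrite mxE mulrDl. Qed.

Lemma dotpZl c x p : dotp (c *: x) p = c * dotp x p.
Proof. by rewrite /dotp mulr_sumr; apply: eq_bigr => i _; rewrite mxE mulrA. Qed.

Lemma dotpC x y : dotp x y = dotp y x.
Proof. by apply: eq_bigr => i _; rewrite mulrC. Qed.

Lemma dotpDr x y p : dotp p (x + y) = dotp p x + dotp p y.
Proof. by rewrite dotpC dotpDl !(dotpC _ p). Qed.

Lemma dotpZr c x p : dotp p (c *: x) = c * dotp p x.
Proof. by rewrite dotpC dotpZl (dotpC _ p). Qed.

Lemma dotpNr x p : dotp p (- x) = - dotp p x.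
Proof. by rewrite -scaleN1r dotpZr mulN1r. Qed.

Lemma dotpNl x p : dotp (- x) p = - dotp x p.
Proof. by rewrite dotpC dotpNr dotpC. Qed.

Lemma dotp_ge0 x : 0 <= dotp x x.
Proof. by apply: sumr_ge0 => i _; rewrite -expr2 sqr_ge0. Qed.

Lemma unit_sphereE x : unit_sphere R k x <-> dotp x x = 1.
Proof. by rewrite /unit_sphere /dotp /=; under eq_bigr do rewrite expr2. Qed.

Lemma dotp_continuous p : continuous (dotp^~ p).
Proof.
move=> x; apply: (@cvg_big _ _ _ _ _ add_continuous _ _ _ _ _ (nbhs_filter x)) => i _.
by apply: cvgM; [apply: coord_continuous | apply: cvg_cst].
Qed.

Lemma dotp_self_continuous : continuous (fun x => dotp x x).
Proof.
move=> x; apply: (@cvg_big _ _ _ _ _ add_continuous _ _ _ _ _ (nbhs_filter x)) => i _.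
by apply: cvgM; apply: coord_continuous.
Qed.

Lemma unit_sphere_closed : closed (unit_sphere R k).
Proof.
have -> : unit_sphere R k = (fun x => dotp x x) @^-1` [set 1].
  by apply/seteqP; split=> x /unit_sphereE.
by apply: (continuous_closedP _).1 => //; apply: dotp_self_continuous.
Qed.

(** The segment from [x] to [y], projected radially to the sphere, stays in the set: its norm is at
    most 1, so normalizing can only increase a product exceeding [c >= 0]. The product with [p] also
    keeps the segment away from 0. The condition on [q] serves to cut a cap by an open
    hemisphere. *)
Lemma cap_connected p q c : 0 <= c ->
  connected [set x | [/\ unit_sphere R k x, c < dotp x p & 0 < dotp x q]].
Proof.
move=> c0; apply: connected_join => x y [/unit_sphereE x1 xp xq] [/unit_sphereE y1 yp yq].
pose g t := (1 - t) *: x + t *: y.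
pose n t := Num.sqrt (dotp (g t) (g t)).
pose h t := (n t)^-1 *: g t.
have gp r t : dotp (g t) r = (1 - t) * dotp x r + t * dotp y r.
  by rewrite dotpDl !dotpZl.
have pos r d t : 0 <= t <= 1 -> d < dotp x r -> d < dotp y r -> d < dotp (g t) r.
  move=> /andP[t0 t1] dx dy; rewrite gp.
  have [->|tn0] := eqVneq t 0; first by rewrite subr0 mul1r mul0r addr0.
  have tp : 0 < t by rewrite lt_neqAle eq_sym tn0.
  by nra.
have gg t : dotp (g t) (g t) = 1 - t * (1 - t) * dotp (x - y) (x - y).
  rewrite /g !(dotpDl, dotpDr, dotpZl, dotpZr, dotpNr, dotpNl) x1 y1 (dotpC y x).
  by ring.
have gg1 t : 0 <= t <= 1 -> dotp (g t) (g t) <= 1.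
  move=> /andP[t0 t1].
  by rewrite gg gerBl !mulr_ge0 ?subr_ge0 ?dotp_ge0.
have gg0 t : 0 <= t <= 1 -> 0 < dotp (g t) (g t).
  move=> t01; rewrite lt_neqAle dotp_ge0 andbT; apply/eqP => /esym g0.
  have : 0 < dotp (g t) p by apply: pos => //; apply: le_lt_trans c0 _.
  suff -> : g t = 0 by rewrite /dotp big1 ?ltxx// => i _; rewrite mxE mul0r.
  apply/rowP => i; rewrite [RHS]mxE; apply/eqP; rewrite -sqrf_eq0 expr2.
  apply/eqP; apply: (psumr_eq0P (P := xpredT) _ g0) => // j _.
  by rewrite -expr2 sqr_ge0.
have n01 t : 0 <= t <= 1 -> 0 < n t <= 1.
  move=> t01; rewrite sqrtr_gt0 gg0//= -sqrtr1 ler_sqrt//.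
  exact: gg1.
exists (h @` `[0, 1]); split.
- apply: connected_continuous_connected; first exact: segment_connected.
  apply: continuous_in_subspaceT => t; rewrite inE /= in_itv /= => t01.
  have cg : {for t, continuous g}.
    apply: cvgD; apply: cvgZr_tmp; last exact: cvg_id.
    by apply: cvgB; [apply: cvg_cst | apply: cvg_id].
  have cn : {for t, continuous n}.
    apply: (@continuous_comp _ _ _ (fun t => dotp (g t) (g t)) Num.sqrt t).
      apply: (@continuous_comp _ _ _ g (fun x => dotp x x) t cg).
      exact: dotp_self_continuous.
    exact: sqrt_continuous.
  apply: cvgZ; last exact: cg.
  apply: cvgV; last exact: cn.
  by have /andP[/lt0r_neq0] := n01 _ t01.
- move=> _ [t + <-]; rewrite /= in_itv /= => t01.
  have /andP[n0 n1] := n01 _ t01.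
  have scale r d : 0 <= d -> d < dotp x r -> d < dotp y r -> d < dotp (h t) r.
    move=> d0 dx dy; rewrite dotpZl mulrC ltr_pdivlMr//.
    by apply: le_lt_trans (pos r d t t01 dx dy); rewrite ler_piMr.
  split; [|exact: scale|exact: scale].
  apply/unit_sphereE; rewrite dotpZl dotpZr.
  have nn : n t * n t = dotp (g t) (g t) by rewrite -expr2 sqr_sqrtr// dotp_ge0.
  by rewrite -nn mulrA -invfM mulVf// mulf_neq0// lt0r_neq0.
- exists 0; first by rewrite /= in_itv /= lexx ler01.
  rewrite /h /n; have -> : g 0 = x by rewrite /g subr0 scale1r scale0r addr0.
  by rewrite x1 sqrtr1 invr1 scale1r.
- exists 1; first by rewrite /= in_itv /= lexx ler01.
  rewrite /h /n; have -> : g 1 = y by rewrite /g subrr scale1r scale0r add0r.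
  by rewrite y1 sqrtr1 invr1 scale1r.
Qed.

End SphereGeometry.

Section Hemispheres.
Variables (R : realType) (k : nat).
Local Open Scope classical_set_scope.
Implicit Types (x p : 'rV[R]_k.+1) (s : bool).

Definition hemisphere s : set 'rV[R]_k.+1 :=
  if s then upper_hemisphere R k else lower_hemisphere R k.

Definition pole s : 'rV[R]_k.+1 := (-1) ^+ (~~ s) *: delta_mx 0 ord_max.

Lemma dotp_pole x s : dotp x (pole s) = (-1) ^+ (~~ s) * x 0 ord_max.
Proof.
rewrite /pole dotpZr; congr (_ * _); rewrite /dotp (bigD1 ord_max)//= big1.
  by rewrite mxE !eqxx mulr1 addr0.
by move=> i ne; rewrite mxE (negPf ne) andbF mulr0.
Qed.

Lemma dotp_pole_self s : dotp (pole s) (pole s) = 1.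
Proof.
rewrite dotp_pole mxE mxE !eqxx mulr1 -expr2 -exprM muln2 -addnn exprD.
by case: s; rewrite ?expr0 ?expr1 ?mulr1// mulrNN mulr1.
Qed.

Lemma open_hemisphereE s : unit_sphere R k `\` hemisphere (~~ s)
  = [set x | unit_sphere R k x /\ 0 < dotp x (pole s)].
Proof.
apply/seteqP; split=> x [Sx nx]; split=> //; move: nx; rewrite dotp_pole;
  case: s; rewrite /hemisphere /upper_hemisphere /lower_hemisphere /=
    ?expr0 ?expr1 ?mul1r ?mulN1r ?oppr_gt0.
- by move=> nx; rewrite ltNge; apply/negP => x0; apply: nx.
- by move=> nx; rewrite ltNge; apply/negP => x0; apply: nx.
- by move=> x0 [_]; rewrite leNgt x0.
- by move=> x0 [_]; rewrite leNgt x0.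
Qed.

Lemma open_hemisphere_connected s : connected (unit_sphere R k `\` hemisphere (~~ s)).
Proof.
have := @cap_connected R k (pole s) (pole s) 0 (lexx _).
rewrite open_hemisphereE; congr connected.
by apply/seteqP; split=> x [] // *; split.
Qed.

Lemma open_hemisphere_nonempty s : unit_sphere R k `\` hemisphere (~~ s) !=set0.
Proof.
exists (pole s); rewrite open_hemisphereE; split; first exact/unit_sphereE/dotp_pole_self.
by rewrite dotp_pole_self ltr01.
Qed.

Lemma hemisphereU : hemisphere true `|` hemisphere false = unit_sphere R k.
Proof.
apply/seteqP; split=> [x [] []//|x Sx].
by have [x0|x0] := leP 0 (x 0 ord_max); [left|right]; split=> //=; apply: ltW.
Qed.

Lemma hemisphereI : hemisphere true `&` hemisphere false = equator R k.
Proof.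
apply/seteqP; split=> [x [[Sx /= x0] [_ /= x1]]|x [Sx /= x0]].
  by split=> //=; apply/eqP; rewrite eq_le x0 x1.
by split; split=> //=; rewrite x0.
Qed.

Lemma hemisphere_closed s : closed (hemisphere s).
Proof.
have last_cont : continuous (fun x => x 0 ord_max) by exact: coord_continuous.
have /continuous_closedP cl := last_cont.
case: s; apply: closedI; try exact: unit_sphere_closed.
  exact: (cl _ (@closed_ge _ 0)).
exact: (cl _ (@closed_le _ 0)).
Qed.

Lemma cap_nbhs p W : unit_sphere R k p -> nbhs p W ->
  exists c, [/\ 0 <= c, c < 1 &
    forall x, unit_sphere R k x -> c < dotp x p -> W x].
Proof.
move=> /unit_sphereE p1 /nbhs_ballP[e /= e0 eW].
(* The squared distance of unit vectors [p] and [x] is [2 - 2 * dotp x p], and the Euclidean norm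
   bounds the coordinatewise one that defines the balls. *)
exists (Num.max 0 (1 - e ^+ 2 / 2)); split.
- by rewrite le_max lexx.
- by rewrite gt_max ltr01 gtrBl divr_gt0// exprn_gt0.
- move=> x /unit_sphereE x1; rewrite gt_max => /andP[_ xp].
  apply: eW; split=> // i j; rewrite !ord1 /ball /= -ltr_sqr ?nnegrE ?normr_ge0 ?(ltW e0)//.
  rewrite real_normK ?num_real//.
  have d2 : dotp (p - x) (p - x) < e ^+ 2.
    rewrite !(dotpDl, dotpDr, dotpNr, dotpNl) p1 x1 (dotpC p x).
    by move: xp; lra.
  apply: le_lt_trans d2; rewrite /dotp (bigD1 j)//= !mxE -expr2 lerDl.
  by apply: sumr_ge0 => l _; rewrite -expr2 sqr_ge0.
Qed.

Lemma cap_nonempty p s c : equator R k p -> 0 <= c -> c < 1 ->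
  exists x, [/\ unit_sphere R k x, c < dotp x p & 0 < dotp x (pole s)].
Proof.
(* Rational parametrization of the great circle from [p] towards the pole; this [t] is small enough
   for [c * (1 + t ^+ 2) < 1 - t ^+ 2]. *)
move=> [/unit_sphereE p1 /= p0] c0 c1; pose t := (1 - c) / 2.
pose x := (1 + t ^+ 2)^-1 *: ((1 - t ^+ 2) *: p + (2 * t) *: pole s).
have t0 : 0 < t by rewrite divr_gt0// subr_gt0.
have d0 : 0 < 1 + t ^+ 2 by rewrite addr_gt0// exprn_gt0.
have pq : dotp p (pole s) = 0 by rewrite dotp_pole p0 mulr0.
have qq := dotp_pole_self s.
move: (pole s) @x pq qq => q x pq qq; exists x; split.
- apply/unit_sphereE; rewrite /x !(dotpDl, dotpDr, dotpZl, dotpZr).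
  rewrite p1 qq pq (dotpC _ p) pq; field.
  exact: lt0r_neq0.
- rewrite /x !(dotpDl, dotpDr, dotpZl, dotpZr) p1 (dotpC _ p) pq mulr0 addr0 mulr1.
  rewrite mulrC ltr_pdivlMr//.
  rewrite /t; nra.
- rewrite /x !(dotpDl, dotpDr, dotpZl, dotpZr) pq qq mulr0 add0r mulr1.
  by rewrite mulr_gt0// ?invr_gt0// mulr_gt0.
Qed.

End Hemispheres.

(** * Sides of a pseudosphere *)

Section Pseudosphere.
Variables (R : realType) (T : topologicalType) (k : nat) (X S P M : set T).
Local Open Scope classical_set_scope.
Hypothesis ps : @pseudosphere R T k X S P M.

Let side (s : bool) := if s then P else M.

Lemma pseudosphere_sides : P `|` M = X /\ P `&` M = S.
Proof.
have [h [[_ [g [_ hX gS hg gh]]] -> -> ->]] := ps.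
have inj x y : unit_sphere R k x -> unit_sphere R k y -> h x = h y -> x = y.
  by move=> Sx Sy e; rewrite -(hg x) ?inE// e hg ?inE.
split.
  rewrite -image_setU -/(hemisphere true) -[lower_hemisphere R k]/(hemisphere false).
  rewrite hemisphereU; apply/seteqP; split=> [_ [x Sx <-]|y Xy]; first exact: hX.
  by exists (g y); [apply: gS | apply: gh; rewrite inE].
rewrite -hemisphereI; apply/seteqP; split=> [_ [[x Px <-] [y My e]]|_ [x [Px Mx] <-]].
  have Sx : unit_sphere R k x by case: Px.
  have Sy : unit_sphere R k y by case: My.
  by exists x => //; split=> //; rewrite -(inj _ _ Sy Sx e).
by split; exists x.
Qed.

Lemma pseudosphere_open_side (s : bool) : exists (h : 'rV[R]_k.+1 -> T) g,
  [/\ {within unit_sphere R k, continuous h}, {within X, continuous g},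
      {in X, cancel g h} /\ (forall x, unit_sphere R k x -> g (h x) = x),
      set_fun (unit_sphere R k) X h /\ set_fun X (unit_sphere R k) g &
      X `\` side (~~ s) = h @` (unit_sphere R k `\` hemisphere (~~ s)) /\
      S = h @` equator R k].
Proof.
have [h [[ch [g [cg hX gS hg gh]]] SE PE ME]] := ps.
have gh' x : unit_sphere R k x -> g (h x) = x by move=> Sx; rewrite hg ?inE.
exists h, g; split=> //; split=> //.
have -> : side (~~ s) = h @` hemisphere (~~ s) by rewrite /side PE ME; case: s.
apply/seteqP; split=> [y [Xy nP]|_ [x [Sx nx] <-]].
  exists (g y); last by rewrite gh ?inE.
  split; first exact: gS.
  by move=> hy; apply: nP; exists (g y) => //; rewrite gh ?inE.
split; first exact: hX.
move=> [y hy e]; apply: nx.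
have Sy : unit_sphere R k y by move: hy; rewrite /hemisphere; case: (~~ s) => -[].
by rewrite -(gh' x)// -e gh'.
Qed.

Lemma open_side_connected s : connected (X `\` side (~~ s)).
Proof.
have [h [g [ch cg _ _ [-> _]]]] := pseudosphere_open_side s.
apply: connected_continuous_connected; first exact: open_hemisphere_connected.
by apply: continuous_subspaceW ch => x [].
Qed.

Lemma open_side_nonempty s : X `\` side (~~ s) !=set0.
Proof.
have [h [g [ch cg _ _ [-> _]]]] := pseudosphere_open_side s.
by have [x Sx] := @open_hemisphere_nonempty R k s; exists (h x); exists x.
Qed.

(** [C] is the image under [h] of a half-cap centred at a point of the equator. Thus each side
    accumulates at every point of [S] and is connected near it. *)
Lemma open_side_locally_connected s x V : S x -> nbhs x V ->
  exists C, [/\ connected C, C !=set0, C `<=` V `&` (X `\` side (~~ s)) &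
    exists2 W, nbhs x W & W `&` (X `\` side (~~ s)) `<=` C].
Proof.
have [h [g [ch cg [gh hg] [hX gS] [-> ->]]]] := pseudosphere_open_side s.
move=> [p ep <-] hV.
have [Sp _] := ep.
have [c [c0 c1 cV]] := cap_nbhs Sp (within_continuous_nbhs ch Sp hV).
pose Z := [set x | [/\ unit_sphere R k x, c < dotp x p & 0 < dotp x (pole R k s)]].
have ZO : Z `<=` unit_sphere R k `\` hemisphere (~~ s).
  by rewrite open_hemisphereE => z [].
exists (h @` Z); split.
- apply: connected_continuous_connected; first exact: cap_connected.
  by apply: continuous_subspaceW ch => z [].
- by have [z Zz] := cap_nonempty s ep c0 c1; exists (h z); exists z.
- move=> _ [z Zz <-]; split; last by exists z => //; apply: ZO.
  by case: Zz => Sz cz _; apply: (cV _ Sz cz).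
- have op : open [set z | c < dotp z p].
    have /continuousP oc := @dotp_continuous R k p.
    exact: (oc _ (@open_gt _ c)).
  have := within_continuous_nbhs cg (hX _ Sp).
  rewrite hg// => /(_ [set z | c < dotp z p]) nW.
  exists [set y | X y -> c < dotp (g y) p].
    apply: nW; apply: open_nbhs_nbhs; split=> //=.
    by move/unit_sphereE : Sp => ->.
  move=> y [cz [z Oz zy]]; rewrite -zy in cz *; have Sz : unit_sphere R k z by case: Oz.
  exists z => //; move: Oz; rewrite open_hemisphereE => -[_ z0]; split=> //.
  by have := cz (hX _ Sz); rewrite hg.
Qed.

Lemma sides_closed s : closed X -> closed (side s).
Proof.
move=> cX.
have [h [g [_ cg [gh hg] [hX gS] []]]] := pseudosphere_open_side (~~ s).
rewrite negbK => sE _.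
suff -> : side s = X `&` g @^-1` @hemisphere R k s.
  by apply: within_continuous_closed => //; apply: hemisphere_closed.
apply/seteqP; split=> [y sy|y [Xy /= gy]]; last first.
  apply: contrapT => nsy; have [] : (X `\` side s) y by [].
  move=> _ _; have : (X `\` side s) y by [].
  by rewrite sE => -[z [Sz nz] zy]; apply: nz; rewrite -(hg z)// zy.
have Xy : X y by have [<- _] := pseudosphere_sides; move: sy; case: (s) => ?; [left|right].
split=> //=; apply: contrapT => ngy.
have : (X `\` side s) y by rewrite sE; exists (g y); [split=> //; apply: gS|rewrite gh ?inE].
by case.
Qed.

End Pseudosphere.

(** * The equator as a sphere of one dimension less *)

Section EquatorDimension.
Variable R : realType.
Local Open Scope classical_set_scope.

Lemma within_continuous_comp (T U V : topologicalType) (A : set T) (B : set U)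
    (f : T -> U) (g : U -> V) :
  {within A, continuous f} -> {within B, continuous g} -> set_fun A B f ->
  {within A, continuous (g \o f)}.
Proof.
move=> cf cg AB; apply/subspace_continuousP => x Ax W /= nW.
have := within_continuous_nbhs cf Ax (within_continuous_nbhs cg (AB _ Ax) nW).
rewrite /within /= nbhs_simpl /=; apply: filterS => y H Ay.
by apply: H => //; apply: AB.
Qed.

Definition equator_embed k (x : 'rV[R]_k.+1) : 'rV[R]_k.+2 :=
  \row_j oapp (x 0) 0 (unlift ord_max j).

Definition equator_proj k (y : 'rV[R]_k.+2) : 'rV[R]_k.+1 :=
  \row_i y 0 (lift ord_max i).

Lemma equator_embed_continuous k : continuous (@equator_embed k).
Proof.
move=> x W /nbhs_ballP[e /= e0 eW]; apply/nbhs_ballP; exists e => // y [_ xy].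
apply: eW; split=> // i j; rewrite !mxE; case: unliftP => [l _|_] /=.
  exact: xy.
exact: ballxx.
Qed.

Lemma equator_proj_continuous k : continuous (@equator_proj k).
Proof.
move=> x W /nbhs_ballP[e /= e0 eW]; apply/nbhs_ballP; exists e => // y [_ xy].
by apply: eW; split=> // i j; rewrite !mxE.
Qed.

Lemma equator_embedK k : cancel (@equator_embed k) (@equator_proj k).
Proof. by move=> x; apply/rowP => i; rewrite !mxE liftK. Qed.

Lemma equator_projK k (y : 'rV[R]_k.+2) :
  y 0 ord_max = 0 -> equator_embed (equator_proj y) = y.
Proof.
move=> y0; apply/rowP => j; rewrite !mxE.
by case: unliftP => [l ->|->] /=; rewrite ?mxE.
Qed.

Lemma sum_sqr_equator k (y : 'rV[R]_k.+2) : y 0 ord_max = 0 ->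
  \sum_i y 0 i ^+ 2 = \sum_i equator_proj y 0 i ^+ 2.
Proof.
move=> y0; rewrite big_ord_recr /= y0 expr0n addr0; apply: eq_bigr => i _.
by rewrite !mxE; congr (y 0 _ ^+ 2); apply: val_inj; rewrite /= /bump leqNgt ltn_ord.
Qed.

Lemma pseudosphere_sphere_dim (T : topologicalType) k (X S P M : set T) :
  pseudosphere R k.+1 X S P M -> sphere_dim R S k.
Proof.
case=> h [[ch [g [cg hX gS hg gh]]] -> _ _].
have fE : set_fun (unit_sphere R k) (equator R k.+1) (@equator_embed k).
  move=> x Sx; have x0 : equator_embed x 0 ord_max = 0 by rewrite mxE unlift_none.
  by split=> //; rewrite /unit_sphere /= sum_sqr_equator// equator_embedK.
have Eg : set_fun (equator R k.+1) (unit_sphere R k) (@equator_proj k).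
  by move=> y [Sy /= y0]; rewrite /unit_sphere /= -sum_sqr_equator.
have ES : equator R k.+1 `<=` unit_sphere R k.+1 by move=> x [].
have EX : h @` equator R k.+1 `<=` X by move=> _ [x /ES Sx <-]; apply: hX.
have gE : set_fun (h @` equator R k.+1) (equator R k.+1) g.
  by move=> _ [x Ex <-]; rewrite hg// inE; apply: ES.
exists (h \o @equator_embed k); split.
  apply: (@within_continuous_comp _ _ _ _ (equator R k.+1)) fE.
    by apply: continuous_subspaceT; apply: equator_embed_continuous.
  exact: continuous_subspaceW ch.
exists (@equator_proj k \o g); split.
- apply: (@within_continuous_comp _ _ _ _ (equator R k.+1)) gE.
    exact: continuous_subspaceW cg.
  by apply: continuous_subspaceT; apply: equator_proj_continuous.
- by move=> x /fE fx; exists (equator_embed x).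
- by move=> y /gE /Eg.
- move=> x; rewrite inE => /fE/ES Sx /=.
  by rewrite hg ?inE// equator_embedK.
- move=> y; rewrite inE => Ey /=; have [_ y0] := gE _ Ey.
  by rewrite equator_projK// gh ?inE//; apply: EX.
Qed.

Lemma equator0 : equator R 0 = set0.
Proof.
apply/seteqP; split=> // x [] /=; rewrite /unit_sphere /= big_ord_recl big_ord0 addr0.
have -> : ord_max = ord0 :> 'I_1 by apply: val_inj.
by move=> x1 x0; move/eqP: x1; rewrite x0 expr0n eq_sym oner_eq0.
Qed.

Lemma unit_sphere_sphere_dim d : sphere_dim R (unit_sphere R d) d.
Proof.
have cid A : {within A, continuous (@id 'rV[R]_d.+1)}.
  by apply: continuous_subspaceT => x; apply: cvg_id.
by exists id; split=> //; exists id; split.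
Qed.

End EquatorDimension.

(** * Pseudosphere arrangements *)

Lemma nbhs_forall (T : topologicalType) (I : finType) (f : I -> set T) (x : T) :
  (forall i, nbhs x (f i)) -> nbhs x [set y | forall i, f i y]%classic.
Proof. by move=> fI; apply: (@filter_forall _ _ f (nbhs x)). Qed.

Section Arrangement.
Variables (R : realType) (d N : nat) (A : signed_arrangement R d N).
Local Open Scope classical_set_scope.
Implicit Types (B : {set 'I_N}) (e : 'I_N) (s : bool) (x y : 'rV[R]_d.+1).

Let sph := unit_sphere R d.
Let S := psphere A.
Let F := flat S.

Definition closed_side e s := if s then pos_side A e else neg_side A e.
Definition open_side e s := unit_sphere R d `\` closed_side e (~~ s).
Let K := closed_side.
Let O := open_side.

Lemma closed_sideU e : K e true `|` K e false = sph.
Proof. by have [] := pseudosphere_sides (psphereP A e). Qed.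

Lemma closed_sideI e : K e true `&` K e false = S e.
Proof. by have [] := pseudosphere_sides (psphereP A e). Qed.

Lemma psphere_sub e : S e `<=` sph.
Proof. by rewrite -closed_sideI -(closed_sideU e) => x [Kx _]; left. Qed.

Lemma closed_side_sub e s : K e s `<=` sph.
Proof. by rewrite -(closed_sideU e) => x; case: s; [left|right]. Qed.

Lemma closed_side_closed e s : closed (K e s).
Proof. have := sides_closed (psphereP A e) (s := s) (@unit_sphere_closed R d).
by []. Qed.

Lemma open_side_psphere e s x : O e s x -> ~ S e x.
Proof. by rewrite -closed_sideI => -[_ nK] [Kt Kf]; apply: nK; case: s. Qed.

Lemma open_side_inj e s s' x : O e s x -> O e s' x -> s = s'.
Proof.
move=> [Sx nK] [_ nK']; have : (K e true `|` K e false) x by rewrite closed_sideU.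
by case: s s' nK nK' => -[] //= nK nK' [].
Qed.

Lemma open_sideP e x : sph x -> ~ S e x -> exists s, O e s x.
Proof.
move=> Sx nS; have [Kf|nKf] := pselect (K e false x); last by exists true.
by exists false; split=> // Kt; apply: nS; rewrite -closed_sideI.
Qed.

Lemma closed_sideP e s x : K e s x <-> S e x \/ O e s x.
Proof.
split=> [Kx|[|[]]].
- have Sx := closed_side_sub Kx.
  have [Sex|nS] := pselect (S e x); [by left|right].
  by split=> // Kx'; apply: nS; rewrite -closed_sideI; case: s Kx Kx'.
- by rewrite -closed_sideI => -[]; case: s.
- rewrite -/(sph x) -(closed_sideU e) => -[]; by case: s.
Qed.

Lemma open_side_near e s x : O e s x -> nbhs x (~` K e (~~ s)).
Proof.
move=> [_ nK]; apply: open_nbhs_nbhs; split=> //.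
by apply: closed_openC; apply: closed_side_closed.
Qed.

Lemma flatP B x : F B x <-> sph x /\ forall e, e \in B -> S e x.
Proof. by split=> -[Sx H]; split=> // e eB; apply: H. Qed.

Lemma flat_sub B : F B `<=` sph. Proof. by move=> x []. Qed.

Lemma flat_mono B B' : B \subset B' -> F B' `<=` F B.
Proof.
move=> /fintype.subsetP BB x /flatP[Sx H]; apply/flatP; split=> // e eB.
by apply: H; apply: BB.
Qed.

Lemma flatU1 B e : F (e |: B) = F B `&` S e.
Proof.
apply/seteqP; split=> [x /flatP[Sx H]|x [/flatP[Sx H] Sex]].
  split; last by apply: H; rewrite !finset.inE eqxx.
  by apply/flatP; split=> // i iB; apply: H; rewrite !finset.inE iB orbT.
by apply/flatP; split=> // i; rewrite !finset.inE => /orP[/eqP ->//|/H].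
Qed.

Lemma flat_set0 : F finset.set0 = sph.
Proof.
apply/seteqP; split=> [|x Sx]; first exact: flat_sub.
by apply/flatP; split=> // e; rewrite finset.inE.
Qed.

Section Transversal.
Variables (B : {set 'I_N}) (e : 'I_N).
Hypotheses (FB : F B !=set0) (nFS : ~ F B `<=` S e).

Let transversal_pseudosphere : exists k,
  pseudosphere R k (F B) (F B `&` S e) (F B `&` K e true) (F B `&` K e false).
Proof.
have [k kB] := @flat_sphere _ _ _ A B FB.
by exists k; apply: (flat_pseudosphere FB nFS kB).
Qed.

Let sideE s : F B `&` O e s
  = F B `\` (if ~~ s then F B `&` K e true else F B `&` K e false).
Proof.
apply/seteqP; split=> [x [Fx [Sx nK]]|x [Fx nK]].
  by split=> // H; apply: nK; case: s H => -[].
split=> //; split; first exact: flat_sub Fx.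
by move=> Kx; apply: nK; case: s Kx.
Qed.

Lemma flat_side_connected s : connected (F B `&` O e s).
Proof.
by have [k ps] := transversal_pseudosphere; rewrite sideE; exact: open_side_connected ps s.
Qed.

Lemma flat_side_nonempty s : F B `&` O e s !=set0.
Proof.
by have [k ps] := transversal_pseudosphere; rewrite sideE; exact: open_side_nonempty ps s.
Qed.

Lemma flat_side_locally_connected s x V : F B x -> S e x -> nbhs x V ->
  exists C, [/\ connected C, C !=set0, C `<=` V `&` (F B `&` O e s) &
    exists2 W, nbhs x W & W `&` (F B `&` O e s) `<=` C].
Proof.
have [k ps] := transversal_pseudosphere; rewrite sideE => Fx Sx nV.
exact: (open_side_locally_connected ps s (conj Fx Sx) nV).
Qed.

(** The strict sides of [x] are open conditions, and both sides of [e] within [F B] accumulate at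
    [x]. This replaces the composition of sign vectors in an oriented matroid. *)
Lemma flat_perturb s x : F B x -> S e x ->
  exists y, [/\ F B y, O e s y & forall e' s', O e' s' x -> O e' s' y].
Proof.
move=> Fx Sx.
have nV : nbhs x [set y | forall p : 'I_N * bool, O p.1 p.2 x -> ~ K p.1 (~~ p.2) y].
  apply: (@nbhs_forall _ _
    (fun (p : 'I_N * bool) y => O p.1 p.2 x -> ~ K p.1 (~~ p.2) y)) => -[e' s'] /=.
  have [Ox|nO] := pselect (O e' s' x); last by apply: filterE => y /nO.
  by apply: filterS (open_side_near Ox) => y nK _.
have [C [_ [y Cy] CV _]] := flat_side_locally_connected s Fx Sx nV.
have [/= Vy [Fy Oy]] := CV _ Cy; exists y; split=> // e' s' Ox.
by split; [apply: flat_sub Fy | apply: (Vy (e', s'))].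
Qed.

End Transversal.

Lemma sphere_transversal e : S e !=set0 -> F finset.set0 !=set0 /\ ~ F finset.set0 `<=` S e.
Proof.
move=> [x Sx]; rewrite flat_set0; split; first by exists x; apply: psphere_sub Sx.
have [y Oy] := open_side_nonempty (psphereP A e) true.
by move/(_ y (proj1 Oy)); apply: (@open_side_psphere _ true).
Qed.

Definition cell B (tau : 'I_N -> bool) (l : seq 'I_N) : set 'rV[R]_d.+1 :=
  [set x | F B x /\ forall e, e \in l -> O e (tau e) x].

Lemma cell_open B tau l x : cell B tau l x ->
  nbhs x [set y | forall e, e \in l -> ~ K e (~~ tau e) y].
Proof.
move=> [_ Ox].
apply: (@nbhs_forall _ _ (fun e y => e \in l -> ~ K e (~~ tau e) y)) => e.
have [el|nel] := boolP (e \in l); last exact: filterE.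
by apply: filterS (open_side_near (Ox _ el)) => y nK _.
Qed.

(* Adding a pseudosphere [e] cuts the connected cell [Q] along the connected
   wall [W]. Near any point of [W] the side [s] of [e] is connected, so the
   points of [W] adherent to a clopen piece [Z] of [Q `&` O e s] form a
   clopen subset of [W]; if it is empty then [Z] is clopen in [Q]. *)
Lemma cell_connected B tau l : l != [::] -> connected (cell B tau l).
Proof.
elim: l B => // e l IH B _.
have cellE : cell B tau (e :: l) = cell B tau l `&` O e (tau e).
  apply/seteqP; split=> [x [Fx H]|x [[Fx H] Oe]].
    split; last by apply: H; rewrite mem_head.
    by split=> // i il; apply: H; rewrite inE il orbT.
  by split=> // i; rewrite inE => /orP[/eqP ->|/H].
have [FB0|/set0P FB] := eqVneq (F B) set0.
  suff -> : cell B tau (e :: l) = set0 by apply: connected0.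
  by apply/seteqP; split=> // x [Fx _]; rewrite -FB0.
have [FS|nFS] := pselect (F B `<=` S e).
  suff -> : cell B tau (e :: l) = set0 by apply: connected0.
  by apply/seteqP; split=> // x; rewrite cellE => -[[/FS Sx _] /open_side_psphere].
have [l0|ln] := eqVneq l [::].
  have -> : cell B tau (e :: l) = F B `&` O e (tau e).
    rewrite cellE l0; apply/seteqP; split=> x [].
      by move=> [].
    by move=> Fx Ox; split=> //; split.
  exact: flat_side_connected.
have cQ := IH B ln; have cW := IH (e |: B) ln.
set Q := cell B tau l in cellE cQ *; set s := tau e in cellE *.
have WE : cell (e |: B) tau l = Q `&` S e.
  by apply/seteqP; split=> x; rewrite /cell /= flatU1 => -[[]].
set W := cell _ _ _ in WE cW.
set Q' := cell B tau (e :: l) in cellE *.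
have loc p V0 : W p -> nbhs p V0 ->
    exists C, [/\ connected C, C !=set0, C `<=` V0 `&` Q' &
      exists2 V, nbhs p V & V `&` Q' `<=` C].
  rewrite WE => -[Qp Sp] nV0; have [Fp _] := Qp.
  have [C [cC C0 CV [V nV VC]]] :=
    flat_side_locally_connected FB nFS s Fp Sp (filterI nV0 (cell_open Qp)).
  exists C; split=> //.
    move=> y /CV[[/= V0y Vy] [Fy Oy]]; rewrite cellE; split=> //; split=> //.
    split=> // i il.
    by split; [apply: flat_sub Fy | apply: Vy].
  by exists V => // y [Vy]; rewrite cellE => -[[Fy _] Oy]; apply: VC.
have opQ' x : Q' x -> nbhs x (~` K e (~~ s)).
  by rewrite cellE => -[_ /open_side_near].
have key Z P D : open P -> closed D -> Z = Q' `&` P -> Z = Q' `&` D ->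
    Z !=set0 -> W `&` closure Z = set0 -> Q `<=` Q'.
  move=> oP cD ZP ZD [z Zz] WZ.
  have oP' : open (P `&` ~` K e (~~ s)).
    by apply: openI => //; apply: closed_openC; apply: closed_side_closed.
  have E : Q `&` (P `&` ~` K e (~~ s)) = Z.
    rewrite ZP cellE; apply/seteqP; split=> [x [Qx [Px nK]]|x [[Qx [Sx nK]] Px]] //.
    by split=> //; split=> //; split=> //; case: Qx => /flat_sub.
  have E' : Q `&` closure Z = Z.
    apply/seteqP; split=> [x [Qx clZ]|x Zx]; last first.
      split; last exact: subset_closure.
      by move: Zx; rewrite ZP cellE => -[[]].
    have Kx : K e s x.
      apply: (closed_side_closed (e := e) (s := s)).
      apply: closure_subset clZ => y; rewrite ZP cellE => -[[_ Oy] _].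
      by apply/closed_sideP; right.
    have Ox : O e s x.
      have [Sx|//] := (closed_sideP _ _ _).1 Kx.
      by have : (W `&` closure Z) x; [rewrite WE | rewrite WZ].
    rewrite ZD cellE; split=> //.
    by apply: cD; apply: closure_subset clZ => y; rewrite ZD => -[].
  have Z1 : Q `&` (P `&` ~` K e (~~ s)) !=set0 by rewrite E; exists z.
  have QP := connected_clopen cQ oP' (@closed_closure _ Z) (etrans E (esym E')) Z1.
  move=> x Qx; have : Z x by rewrite -E; split=> //; apply: QP.
  by rewrite ZP => -[].
move=> Z Z0 [P oP ZP] [D cD ZD]; apply: contrapT => ZQ'.
pose Z' := Q' `&` ~` D.
have Z'E : Z' = Q' `&` ~` P.
  have PD x : Q' x -> P x <-> D x.
    move=> Qx; have -> : P x <-> Z x by rewrite ZP; split=> [?|[]].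
    by rewrite ZD; split=> [[]|].
  by apply/seteqP; split=> x [Qx nx]; split=> // /(PD x Qx).
have [x0 Z'x0] : Z' !=set0.
  apply/set0P/eqP => Z'0; apply: ZQ'; apply/seteqP; split=> x.
    by rewrite ZP => -[].
  move=> Qx; rewrite ZD; split=> //; apply: contrapT => nD.
  by have : Z' x by []; rewrite Z'0.
have adh_excl p : W p -> closure Z p -> ~ closure Z' p.
  move=> Wp clZ clZ'; have [C [cC [c Cc] CQ [V nV VC]]] := loc _ _ Wp filterT.
  have CQ' x : C x -> Q' x by move=> /CQ[].
  have CZ x : C x -> P x <-> Z x by move=> /CQ' Qx; rewrite ZP; split=> [?|[]].
  have CZ' : C `&` P = C `&` D.
    apply/seteqP; split=> x [Cx Px]; split=> //; have Qx := CQ' _ Cx.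
      by have : Z x; [rewrite ZP | rewrite ZD => -[]].
    by have : Z x; [rewrite ZD | rewrite ZP => -[]].
  have [z [Zz Vz]] := clZ _ nV; have [z' [Z'z' Vz']] := clZ' _ nV.
  have CP : C `<=` P.
    apply: (connected_clopen cC oP cD CZ'); exists z; split.
      by apply: VC; split=> //; move: Zz; rewrite ZP => -[].
    by move: Zz; rewrite ZP => -[].
  have Cz' : C z' by apply: VC; split=> //; case: Z'z'.
  by move: Z'z'; rewrite Z'E => -[_]; apply; apply: CP.
have adh_cover p : W p -> ~ closure Z p -> closure Z' p.
  move=> Wp nclZ V1 nV1.
  have nV0 : nbhs p (~` closure Z).
    by apply: open_nbhs_nbhs; split=> //; apply/closed_openC/closed_closure.
  have [C [_ [c Cc] CV _]] := loc _ _ Wp (filterI nV1 nV0).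
  have [[V1c nc] Qc] := CV _ Cc; exists c; split=> //; split=> // Dc.
  by apply: nc; apply: subset_closure; rewrite ZD.
have adhE : W `&` ~` closure Z' = W `&` closure Z.
  apply/seteqP; split=> p [Wp nc]; split=> //.
    by apply: contrapT => /(adh_cover p Wp).
  exact: adh_excl.
have QQ' : Q `<=` Q'.
  have [WZ0|/set0P WZ] := eqVneq (W `&` closure Z) set0.
    exact: (key _ _ _ oP cD ZP ZD Z0 WZ0).
  have oZ' : open (~` closure Z') by apply/closed_openC/closed_closure.
  have WP := connected_clopen cW oZ' (@closed_closure _ Z) adhE.
  rewrite adhE in WP; have WZ' : W `&` closure Z' = set0.
    by apply/seteqP; split=> // x [Wx cx]; apply: (WP WZ x Wx).
  apply: (key Z' (~` D) (~` P)) => //; last by exists x0.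
    exact: closed_openC.
  exact: open_closedC.
have QE : Q' = Q by apply/seteqP; split=> // x; rewrite cellE => -[].
apply: ZQ'; rewrite QE in ZP ZD *.
by apply: cQ => //; [exists P | exists D].
Qed.

End Arrangement.

(** * Regions and circuits *)

Section Regions.
Variables (R : realType) (d N : nat) (A : signed_arrangement R d N).
Local Open Scope classical_set_scope.
Implicit Types (B D : {set 'I_N}) (e : 'I_N) (s : bool) (x y : 'rV[R]_d.+1).

Let sph := unit_sphere R d.
Let S := psphere A.
Let F := flat S.
Let K := @closed_side R d N A.
Let O := @open_side R d N A.

(** Away from [S e] the open and the closed side coincide, so a side is clopen in [Y]. *)
Lemma connected_one_side (Y : set 'rV[R]_d.+1) e s y :
  connected Y -> Y `<=` sph -> (forall z, Y z -> ~ S e z) -> Y y -> O e s y ->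
  Y `<=` O e s.
Proof.
move=> cY Ysph YS Yy Oy z Yz; split; first exact: Ysph.
have oK : open (~` K e (~~ s)) by apply/closed_openC/closed_side_closed.
apply: (connected_clopen cY oK (@closed_side_closed _ _ _ A e s)) z Yz.
  apply/seteqP; split=> z [Yz Kz]; split=> //.
    by apply/closed_sideP; right; split=> //; apply: Ysph.
  by have /closed_sideP[/(YS z Yz)//|[]] := Kz.
by exists y; split=> //; case: Oy.
Qed.

Lemma arr_complementP x : arr_complement A x <-> sph x /\ forall e, ~ S e x.
Proof.
split=> [[Sx nS]|[Sx nS]]; split=> //; first by move=> e Sex; apply: nS; exists e.
by move=> [e _ /nS].
Qed.

Lemma region_signP x e : arr_complement A x ->
  region_sign A (connected_component (arr_complement A) x) e = `[< O e true x >].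
Proof.
move=> cx; have [Sx nS] := (arr_complementP x).1 cx.
rewrite /region_sign; apply: asbool_equiv_eq; split=> [sub|Ox y cy].
  have : closed_side A e true x := sub x (connected_component_refl cx).
  by case/closed_sideP => [/nS|].
have sub := @connected_component_sub _ (arr_complement A) x.
suff : closed_side A e true y by [].
apply/closed_sideP; right.
apply: (connected_one_side _ _ _ _ Ox) cy; first exact: component_connected.
- by move=> z /sub[].
- by move=> z /sub/arr_complementP[].
- exact: connected_component_refl.
Qed.

(** Each region meets the cell of a full sign vector; this cell is connected, so the sign vector
    determines the region. *)
Lemma regions_finite : (0 < N)%N -> finite_set (regions A).
Proof.
move=> N0; pose Q (tau : {ffun 'I_N -> bool}) := cell A finset.set0 tau (enum 'I_N).
(* The list of constraints must be nonempty: a flat may be a 0-sphere, which is disconnected. *)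
have cQ tau : connected (Q tau).
  by apply: cell_connected; rewrite -size_eq0 size_enum_ord -lt0n.
have Qsub tau : Q tau `<=` arr_complement A.
  move=> x [/flat_sub Sx Ox]; apply/arr_complementP; split=> // e.
  by apply: (@open_side_psphere _ _ _ _ _ (tau e)); apply: Ox; rewrite mem_enum.
pose r (tau : {ffun 'I_N -> bool}) :=
  connected_component (arr_complement A) (get (Q tau)).
apply: (@sub_finite_set _ _ (range r)); last first.
  by apply: finite_image; apply: finite_finset.
move=> _ [x cx ->]; have [Sx nS] := (arr_complementP x).1 cx.
pose tau := [ffun e => `[< O e true x >]].
have Qx : Q tau x.
  split; first by rewrite flat_set0.
  move=> e _; have [s Os] := open_sideP Sx (nS e).
  by rewrite ffunE; case: asboolP => // nO; case: s Os.
exists tau => //; rewrite /r.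
have Qg : Q tau (get (Q tau)) by apply: getI Qx.
apply: same_connected_component.
exact: (connected_component_max Qg (Qsub _) (cQ _)).
Qed.

Lemma region_seq_nth (i : 'I_(size (region_seq A))) : (0 < N)%N ->
  exists2 x, arr_complement A x &
    nth set0 (region_seq A) i = connected_component (arr_complement A) x.
Proof.
move=> N0; have : nth set0 (region_seq A) i \in region_seq A by apply: mem_nth.
by rewrite /region_seq in_fset_set ?inE; [|exact: regions_finite].
Qed.

Lemma region_seq_index x : (0 < N)%N -> arr_complement A x ->
  exists i : 'I_(size (region_seq A)),
    nth set0 (region_seq A) i = connected_component (arr_complement A) x.
Proof.
move=> N0 cx.
have xr : connected_component (arr_complement A) x \in region_seq A.
  by rewrite /region_seq in_fset_set ?inE; [exists x|exact: regions_finite].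
have ix : (index (connected_component (arr_complement A) x) (region_seq A)
           < size (region_seq A))%N by rewrite index_mem.
by exists (Ordinal ix); rewrite nth_index.
Qed.

(** Dependence as in a matroid, but only for sets with nonempty flat, the only ones that
    semigenerality constrains. *)
Definition dependent B := F B !=set0 /\ exists2 e, e \in B & F (B :\ e) `<=` S e.

(** Without dependent sets, each further pseudosphere cuts the flat in an equator and lowers its
    dimension by one. A 0-sphere cannot occur before the last cut, since its equator is empty. *)
Lemma nonsemigeneral_dependent : ~ semigeneral A -> exists B, dependent B.
Proof.
apply: contra_notP => nD B; have [n] := ubnP #|B|.
elim: n B => // n IH B Bn FB.
have [B0|[e eB]] := set_0Vmem B.
  exists d; last by rewrite B0 cards0 addn0.
  by rewrite B0 flat_set0; apply: unit_sphere_sphere_dim.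
have FBe : F (B :\ e) !=set0.
  by case: FB => x /(flat_mono (finset.subD1set B e)); exists x.
have nFS : ~ F (B :\ e) `<=` S e by move=> FS; apply: nD; exists B; split=> //; exists e.
have cB : #|B| = #|B :\ e|.+1 by rewrite (cardsD1 e) eB.
have FE : F B = F (B :\ e) `&` S e by rewrite -flatU1 finset.setD1K.
have [k sk kd] : exists2 k, sphere_dim R (F (B :\ e)) k & (k + #|B :\ e|)%N = d.
  by apply: IH => //; rewrite -ltnS -cB.
have := flat_pseudosphere FBe nFS sk; rewrite -FE.
case: k sk kd => [|k] sk kd ps.
  case: ps => h [_ FBE _ _]; have : F B !=set0 by [].
  by rewrite FBE equator0 image_set0 => -[].
exists k; first exact: pseudosphere_sphere_dim ps.
by rewrite cB addnS -addSn.
Qed.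

Lemma circuit_exists : ~ semigeneral A -> exists B, dependent B /\
  forall B', B' \proper B -> ~ dependent B'.
Proof.
move=> /nonsemigeneral_dependent[B0 D0].
have [B /minsetP[/asboolP DB minB]] :=
  @ex_minset _ (fun B => `[< dependent B >]) (ex_intro _ B0 (asboolT D0)).
exists B; split=> // B' /[dup] B'B /fintype.proper_sub B'sub DB'.
by have := minB B' (asboolT DB') B'sub => BE; rewrite BE fintype.properxx in B'B.
Qed.

Let FU1 B e : F (e |: B) = F B `&` S e. Proof. exact: flatU1. Qed.

(** Let [x] in [F B] lie on [S f] but strictly on side [s] of [e]. Some point opposite to it with
    respect to [e] lies strictly on a side [s'] of [f]. The hemisphere [F B] on side [s'] of [f] is
    connected and misses [S e], so it lies entirely opposite to [x]; but [x] can be pushed into it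
    without leaving its side of [e]. *)
Lemma flat_exchange B e f : F B !=set0 -> ~ F B `<=` S e -> ~ F B `<=` S f ->
  F (e |: B) `<=` S f -> F (f |: B) `<=` S e.
Proof.
move=> FB ne nf; rewrite !FU1 => ef x [Fx Sfx]; apply: contrapT => nSe.
have [s Os] := open_sideP (flat_sub Fx) nSe.
have [z [Fz Oz]] := flat_side_nonempty FB ne (~~ s).
have [z' [s' [Fz' Ofz' Oez']]] : exists z' s', [/\ F B z', O f s' z' & O e (~~ s) z'].
  have [Sfz|nSfz] := pselect (S f z); last first.
    by have [s' Ofz] := open_sideP (flat_sub Fz) nSfz; exists z, s'.
  have [z' [Fz' Oz' pres]] := flat_perturb FB nf true Fz Sfz.
  by exists z', true; split=> //; apply: pres.
have [y [Fy Oy pres]] := flat_perturb FB nf s' Fx Sfx.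
have sub : F B `&` O f s' `<=` O e (~~ s).
  apply: (connected_one_side (y := z')) => //; first exact: flat_side_connected.
    by move=> w [/flat_sub].
  by move=> w [Fw /open_side_psphere nSf Sew]; apply: nSf; apply: ef.
have := open_side_inj (sub y (conj Fy Oy)) (pres _ _ Os).
by case: (s).
Qed.

(** * Sign vectors on a circuit *)

Section Circuit.
Variable B : {set 'I_N}.
Hypothesis B_neq0 : exists e, e \in B.
Hypothesis FB : F B !=set0.
Hypothesis circ : forall e, e \in B -> F (B :\ e) `<=` S e.
Hypothesis indep : forall B' e, B' \proper B -> e \in B' -> ~ F (B' :\ e) `<=` S e.
Hypothesis distinct : injective S.

(** Indexing by the omitted elements makes [X D] grow with [D], from [F B] to the whole sphere at
    [D = B]. *)
Local Notation X D := (F (B :\: D)).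

Lemma coflat_nonempty D : X D !=set0.
Proof. by case: FB => x Fx; exists x; apply: flat_mono Fx; apply: finset.subsetDl. Qed.

Lemma coflat_mono D D' : D' \subset D -> X D' `<=` X D.
Proof. by move=> DD; apply: flat_mono; apply: finset.setDS. Qed.

Lemma coflat_inter D D' x : X D x -> {in D, forall i, i \in D' \/ S i x} -> X D' x.
Proof.
move=> /flatP[Sx H] DD; apply/flatP; split=> // i /finset.setDP[iB iD'].
have [iD|iD] := boolP (i \in D); last by apply: H; rewrite finset.inE iD.
by case: (DD i iD) => //; rewrite (negPf iD').
Qed.

(** Adding [e] back to [B :\: D] still leaves out [f], hence gives a proper and so independent
    subset of the circuit. *)
Lemma coflat_transversal D e f : e \in D -> f \in D -> e \in B -> f \in B ->
  e != f -> ~ X D `<=` S e.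
Proof.
move=> eD fD eB fB ef; have -> : X D = F ((e |: (B :\: D)) :\ e).
  by rewrite finset.setU1K// finset.inE eD.
apply: indep; last by rewrite !finset.inE eqxx.
apply/fintype.properP; split.
  by rewrite finset.subUset finset.sub1set eB finset.subsetDl.
by exists f => //; rewrite !finset.inE fD eq_sym (negPf ef).
Qed.

Lemma coflat1 e : e \in B -> X [set e] `<=` S e.
Proof. exact: circ. Qed.

(** With one element the whole sphere would lie in [S e]; with two, each pseudosphere would contain
    the other, against [distinct]. *)
Lemma circuit_card : (2 < #|B|)%N.
Proof.
rewrite ltnNge; apply/negP => B2.
have nS e : e \in B -> S e !=set0.
  by move=> eB; case: FB => x /flatP[_ H]; exists x; apply: H.
have [e eB] := B_neq0.
have [/forallP H|] := boolP [forall f, (f \in B) ==> (f == e)].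
  apply: (sphere_transversal (nS e eB)).2 => x /flat_sub Sx; apply: circ => //.
  apply/flatP; split=> // i /finset.setD1P[ie iB].
  by have := H i; rewrite iB (negPf ie).
rewrite negb_forall => /existsP[f]; rewrite negb_imply => /andP[fB fe].
have BE : B = [set f; e]%SET.
  apply/esym/eqP; rewrite eqEcard cards2 fe B2 andbT.
  by rewrite finset.subUset !finset.sub1set fB eB.
have sub a b : a \in B -> b \in B -> (forall i, i \in B -> i != b -> i = a) -> S a `<=` S b.
  move=> aB bB ab x Sx; apply: circ => //; apply/flatP.
  split; first exact: psphere_sub Sx.
  by move=> i /finset.setD1P[ib iB]; rewrite (ab i).
move/eqP: fe; apply; apply: distinct; apply/seteqP; split; apply: sub => // i.
  by rewrite BE !finset.inE => /orP[]/eqP -> //; rewrite eqxx.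
by rewrite BE !finset.inE => /orP[]/eqP -> //; rewrite eqxx.
Qed.

(** On [X [set a; b]] the pseudospheres [S a] and [S b] have the same trace, so the sides of [a] are
    those of [b]; the boolean records whether they are interchanged. *)
Definition pair_sign a b : bool :=
  `[< forall s x, X [set a; b] x -> O a s x -> O b (~~ s) x >].

Lemma pair_signP a b s x : a \in B -> b \in B -> a != b ->
  X [set a; b] x -> O a s x -> O b (s (+) pair_sign a b) x.
Proof.
move=> aB bB ab.
have ba : b != a by rewrite eq_sym.
have aD : a \in [set a; b]%SET by rewrite !finset.inE eqxx.
have bD : b \in [set a; b]%SET by rewrite !finset.inE eqxx orbT.
have X0 := coflat_nonempty [set a; b].
have ta := coflat_transversal aD bD aB bB ab.
have tb := coflat_transversal bD aD bB aB ba.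
have SbSa y : X [set a; b] y -> S b y -> S a y.
  move=> Xy Sb; apply: coflat1 => //; apply: coflat_inter Xy _ => i.
  by rewrite !finset.inE => /orP[]/eqP ->; rewrite ?eqxx; [left|right].
have SaSb y : X [set a; b] y -> S a y -> S b y.
  move=> Xy Sa; apply: coflat1 => //; apply: coflat_inter Xy _ => i.
  by rewrite !finset.inE => /orP[]/eqP ->; rewrite ?eqxx; [right|left].
have side u y : X [set a; b] y -> O a u y -> exists v, X [set a; b] `&` O a u `<=` O b v.
  move=> Xy Oy; have nSb : ~ S b y by move=> /(SbSa y Xy); apply: open_side_psphere Oy.
  have [v Ov] := open_sideP (flat_sub Xy) nSb; exists v.
  apply: (connected_one_side (y := y)) => //; first exact: flat_side_connected.
    by move=> w [/flat_sub].
  by move=> w [Xw Ow] /(SbSa w Xw); apply: open_side_psphere Ow.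
have [x1 [Xx1 Ox1]] := flat_side_nonempty X0 ta true.
have [x2 [Xx2 Ox2]] := flat_side_nonempty X0 ta false.
have [v1 sub1] := side _ _ Xx1 Ox1; have [v2 sub2] := side _ _ Xx2 Ox2.
(* If both sides of [a] lay on the same side of [b], the other side of [b] would be empty. *)
have v12 : v2 = ~~ v1.
  have [y [Xy Oy]] := flat_side_nonempty X0 tb (~~ v1).
  have nSa : ~ S a y by move=> /(SaSb y Xy); apply: open_side_psphere Oy.
  have [[] Oa] := open_sideP (flat_sub Xy) nSa.
    by have := open_side_inj (sub1 _ (conj Xy Oa)) Oy; case: (v1).
  exact: open_side_inj (sub2 _ (conj Xy Oa)) Oy.
have all u y : X [set a; b] y -> O a u y -> O b (u (+) ~~ v1) y.
  move=> Xy Oy; case: u Oy => Oy.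
    by rewrite addTb negbK; apply: sub1.
  by rewrite addFb -v12; apply: sub2.
move=> Xx Ox; rewrite /pair_sign; case: asboolP => [H|nH].
  by rewrite addbT; apply: H.
case: (v1) all => [all|all]; first exact: all.
case: nH => u y Xy Oy; have := all u y Xy Oy; by rewrite addbT.
Qed.

Lemma pair_signE a b s u x : a \in B -> b \in B -> a != b ->
  X [set a; b] x -> O a s x -> O b u x -> pair_sign a b = s (+) u.
Proof.
move=> aB bB ab Xx Oa Ob; have := open_side_inj (pair_signP aB bB ab Xx Oa) Ob.
by move=> <-; rewrite addbA addbb.
Qed.

Lemma pair_signC a b : a \in B -> b \in B -> a != b -> pair_sign a b = pair_sign b a.
Proof.
move=> aB bB ab; have ba : b != a by rewrite eq_sym.
have aD : a \in [set a; b]%SET by rewrite !finset.inE eqxx.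
have bD : b \in [set a; b]%SET by rewrite !finset.inE eqxx orbT.
have [x [Xx Ox]] := flat_side_nonempty (coflat_nonempty [set a; b])
  (coflat_transversal aD bD aB bB ab) true.
have Obx := pair_signP aB bB ab Xx Ox.
rewrite [RHS](pair_signE bB aB ba _ Obx Ox); first by case: (pair_sign a b).
by rewrite finset.setUC.
Qed.

(* Otherwise, after reorientation, the sides of any two of [a], [b], [c] agree on
   the third. Then the points of [X [set a; b; c]] on the side [true] of [a]
   where [b] and [c] have the sides opposite to the expected ones form a clopen
   subset of that side, and it is neither empty nor everything. *)
Lemma pair_sign_triple a b c : a \in B -> b \in B -> c \in B ->
  a != b -> b != c -> a != c ->
  pair_sign a b (+) pair_sign b c (+) pair_sign a c.
Proof.
move=> aB bB cB ab bc ac; apply: contraT => /negPf par.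
pose D := [set a; b; c]%SET.
have subD u v : u \in D -> v \in D -> [set u; v]%SET \subset D.
  by move=> uD vD; rewrite finset.subUset !finset.sub1set uD vD.
have aD : a \in D by rewrite !finset.inE eqxx.
have bD : b \in D by rewrite !finset.inE eqxx orbT.
have cD : c \in D by rewrite !finset.inE eqxx orbT.
have ne u v : u \in B -> v \in B -> u != v -> X [set u; v] `&` O u true !=set0.
  move=> uB vB uv; apply: flat_side_nonempty; first exact: coflat_nonempty.
  by apply: (@coflat_transversal _ u v); rewrite // !finset.inE eqxx ?orbT.
have ta : ~ X D `<=` S a by apply: (@coflat_transversal D a b).
have cXa : connected (X D `&` O a true).
  by have XD0 := coflat_nonempty D; exact: flat_side_connected.
pose P := ~` K b (~~ pair_sign a b) `&` ~` K c (~~ pair_sign a c).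
pose Q := K b (pair_sign a b) `&` K c (pair_sign a c).
have oP : open P by apply: openI; apply/closed_openC/closed_side_closed.
have cQ : closed Q by apply: closedI; apply: closed_side_closed.
have onb x : X D x -> O a true x -> S b x -> O c (~~ pair_sign a c) x.
  move=> Xx Oa Sb; rewrite -addTb; apply: pair_signP Oa => //.
  apply: coflat_inter Xx _ => i; rewrite !finset.inE => /orP[/orP[]|]/eqP ->;
    rewrite ?eqxx ?orbT; [by left|by right|by left].
have onc x : X D x -> O a true x -> S c x -> O b (~~ pair_sign a b) x.
  move=> Xx Oa Sc; rewrite -addTb; apply: pair_signP Oa => //.
  apply: coflat_inter Xx _ => i; rewrite !finset.inE => /orP[/orP[]|]/eqP ->;
    rewrite ?eqxx ?orbT; [by left|by left|by right].
have E : (X D `&` O a true) `&` P = (X D `&` O a true) `&` Q.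
  apply/seteqP; split=> x [[Xx Oa] [Kb Kc]]; have Sx := flat_sub Xx; split=> //.
    by split; apply/closed_sideP; right; split.
  have nSb : ~ S b x.
    move=> /(onb x Xx Oa) Oc; have /closed_sideP[Sc|Oc'] := Kc.
      exact: open_side_psphere Oc Sc.
    by have := open_side_inj Oc Oc'; case: (pair_sign a c).
  have nSc : ~ S c x.
    move=> /(onc x Xx Oa) Ob; have /closed_sideP[Sb|Ob'] := Kb.
      exact: open_side_psphere Ob Sb.
    by have := open_side_inj Ob Ob'; case: (pair_sign a b).
  by split; [have /closed_sideP[|[]] := Kb | have /closed_sideP[|[]] := Kc].
have tbc : ~ X [set b; c] `<=` S b.
  by apply: (@coflat_transversal _ b c); rewrite // !finset.inE eqxx ?orbT.
have [z [Xz Ob]] := flat_side_nonempty (coflat_nonempty [set b; c]) tbc (pair_sign a b).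
have Oc := pair_signP bB cB bc Xz Ob.
have XDz : X D z by apply: coflat_mono Xz; apply: subD.
have Sa : S a z.
  by have /flatP[_] := Xz; apply; rewrite !finset.inE aB (negPf ab) (negPf ac).
have [y [XDy Oya pres]] := flat_perturb (coflat_nonempty D) ta true XDz Sa.
have Oyc : O c (pair_sign a c) y.
  have -> : pair_sign a c = pair_sign a b (+) pair_sign b c.
    by move: par; case: (pair_sign a b); case: (pair_sign b c); case: (pair_sign a c).
  exact: pres.
have sub : X D `&` O a true `<=` P.
  apply: (connected_clopen cXa oP cQ E); exists y; split=> //.
  by split; [have [] := pres _ _ Ob | have [] := Oyc].
have [w [Xw Ow]] := ne a b aB bB ab.
have XDw : X D w by apply: coflat_mono Xw; apply: subD.
have [Kb _] := sub w (conj XDw Ow); exfalso; apply: Kb.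
have := pair_signP aB bB ab Xw Ow; rewrite addTb => Obw.
by apply/closed_sideP; right.
Qed.

(** By the triple relation, reversing the elements whose sides are not interchanged with those of a
    fixed [a0] makes every [pair_sign] on [B] true. The set [c] of reversed elements is the sign
    vector of the circuit: [c] and its complement in [B] are the two missing vertices of the
    cube. *)
Lemma circuit_signs : exists c : {set 'I_N}, c \subset B /\
  forall a b s x, a \in B -> b \in B -> a != b -> X [set a; b] x ->
    O a ((a \in c) (+) s) x -> O b ((b \in c) (+) ~~ s) x.
Proof.
have [a0 a0B] := B_neq0.
exists [set e in B | (e != a0) && ~~ pair_sign a0 e]%SET; split.
  by apply/fintype.subsetP => e; rewrite finset.inE => /andP[].
move=> a b s x aB bB ab Xx; rewrite !finset.inE aB bB /= => Oa.
have := pair_signP aB bB ab Xx Oa; congr (O b _ x).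
have [ae|ae] := eqVneq a a0.
  by rewrite -ae (eq_sym b) ab /= addbC; case: (pair_sign a b); case: s {Oa}.
have [be|be] := eqVneq b a0.
  by rewrite be (pair_signC aB a0B ae) /=; case: (pair_sign a0 a); case: s {Oa}.
have a0a : a0 != a by rewrite eq_sym.
have a0b : a0 != b by rewrite eq_sym.
by have := pair_sign_triple a0B aB bB a0a ab a0b; case: (pair_sign a0 a);
  case: (pair_sign a b); case: (pair_sign a0 b); case: s {Oa}.
Qed.

Section Signs.
Variable c : {set 'I_N}.
Hypothesis cP : forall a b s x, a \in B -> b \in B -> a != b ->
  X [set a; b] x -> O a ((a \in c) (+) s) x -> O b ((b \in c) (+) ~~ s) x.

(* By induction no point of [X D] with the prescribed sides lies on a
   pseudosphere of [D :\ a], so these points form a clopen subset of the open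
   hemisphere [X D `&` O a _]. It is not everything, since [b] has the other side
   on [X [set a; b] `&` O a _]. *)
Lemma circuit_sign_missing D s x : D \subset B -> D != finset.set0 -> X D x ->
  ~ (forall e, e \in D -> O e ((e \in c) (+) s) x).
Proof.
have [n] := ubnP #|D|; elim: n D x => // n IH D x Dn DB /set0Pn[a aD] Xx OD.
have aB := fintype.subsetP DB _ aD.
pose t e := (e \in c) (+) s.
have [/forallP H|] := boolP [forall e, (e \in D) ==> (e == a)].
  apply: (open_side_psphere (OD a aD)); apply: coflat1 => //.
  apply: coflat_inter Xx _ => i iD; left; rewrite finset.inE.
  by have := H i; rewrite iD.
rewrite negb_forall => /existsP[b]; rewrite negb_imply => /andP[bD ba].
have bB := fintype.subsetP DB _ bD; have ab : a != b by rewrite eq_sym.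
have ta := coflat_transversal aD bD aB bB ab.
have cXa : connected (X D `&` O a (t a)).
  by have XD0 := coflat_nonempty D; exact: flat_side_connected.
pose P := [set y | forall e, e \in D :\ a -> ~ K e (~~ t e) y].
pose Q := [set y | forall e, e \in D :\ a -> K e (t e) y].
have oP : open P.
  rewrite openE => y Py.
  apply: (@nbhs_forall _ _ (fun e y => e \in D :\ a -> ~ K e (~~ t e) y)).
  move=> e; have [eD|] := boolP (e \in D :\ a); last by move=> nD; apply: filterE.
  apply: (@filterS _ (nbhs y) _ (~` K e (~~ t e))); first by move=> z nK _.
  apply: open_nbhs_nbhs; split; last exact: Py.
  by apply/closed_openC/closed_side_closed.
have cQ : closed Q.
  move=> y cy e eD; apply: (@closed_side_closed _ _ _ A e (t e)).
  by apply: closure_subset cy => z; apply.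
have E : (X D `&` O a (t a)) `&` P = (X D `&` O a (t a)) `&` Q.
  apply/seteqP; split=> y [[Xy Oa] Py]; split=> // e eD.
    apply/closed_sideP; right; split; first exact: flat_sub Xy.
    exact: Py.
  have nS e' : e' \in D -> ~ S e' y.
    move=> e'D Se'; pose Z := [set e in D | `[< S e y >]]%SET.
    have aZ : a \notin Z.
      by rewrite finset.inE aD; apply/asboolP; apply: open_side_psphere Oa.
    apply: (IH (D :\: Z) y).
    - rewrite -ltnS; apply: leq_trans Dn; rewrite ltnS; apply: proper_card.
      apply/fintype.properP; split; first exact: finset.subsetDl.
      by exists e' => //; rewrite finset.inE negb_and negbK finset.inE e'D asboolT.
    - exact: fintype.subset_trans (finset.subsetDl _ _) DB.
    - by apply/set0Pn; exists a; rewrite finset.inE aD aZ.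
    - apply: coflat_inter Xy _ => i iD; rewrite !finset.inE iD /= andbT.
      by case: asboolP => Si; [right|left].
    - move=> i /finset.setDP[iD]; rewrite finset.inE iD /= => /asboolP nSi.
      have [->//|ia] := eqVneq i a.
      have : K i (t i) y by apply: Py; rewrite finset.inE iD finset.inE ia.
      by case/closed_sideP.
  have /closed_sideP[Se|[]//] := Py e eD.
  by case: (nS e) => //; move: eD; rewrite finset.inE => /andP[].
have sub : X D `&` O a (t a) `<=` P.
  apply: (connected_clopen cXa oP cQ E); exists x; split; first by split=> //; apply: OD.
  by move=> e /finset.setD1P[_ eD]; have [] := OD e eD.
have ta' : ~ X [set a; b] `<=` S a.
  by apply: (@coflat_transversal _ a b); rewrite // !finset.inE eqxx ?orbT.
have [w [Xw Ow]] := flat_side_nonempty (coflat_nonempty [set a; b]) ta' (t a).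
have XDw : X D w.
  by apply: coflat_mono Xw; rewrite finset.subUset !finset.sub1set aD bD.
apply: (sub w (conj XDw Ow) b); first by rewrite !finset.inE ba bD.
by apply/closed_sideP; right; rewrite -addbN; apply: cP Ow.
Qed.

(** Since [tau] differs from [c] at [a] and agrees with it at [b], a point of [X [set a; b]] on the
    right side of [a] is automatically on the right side of [b]. Perturbations push it off the other
    pseudospheres one at a time, with prescribed sides in [B] and arbitrary ones elsewhere. *)
Lemma circuit_sign_realized (tau : 'I_N -> bool) a b : a \in B -> b \in B ->
  tau a != (a \in c) -> tau b = (b \in c) ->
  exists x, arr_complement A x /\ forall e, e \in B -> O e (tau e) x.
Proof.
move=> aB bB ta tb.
have ab : a != b by apply: contraNneq ta => ->; rewrite tb.
have ta' : ~ X [set a; b] `<=` S a.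
  by apply: (@coflat_transversal _ a b); rewrite // !finset.inE eqxx ?orbT.
have [x0 [Xx0 Oa]] := flat_side_nonempty (coflat_nonempty [set a; b]) ta' (tau a).
have Ob : O b (tau b) x0.
  rewrite tb -[b \in c]addbF; apply: (cP (s := true) aB bB ab Xx0).
  by move: Oa; congr (O a _ x0); move: ta; case: (tau a); case: (a \in c).
(* [G] is the part of [B] still to be settled. As it contains neither [a] nor [b], every [S g] with
   [g] in [G] cuts [F (G :\ g)] transversally. *)
have off_B (G : {set 'I_N}) x : G \subset B :\: [set a; b] -> F G x ->
    (forall e, e \in B :\: G -> O e (tau e) x) ->
    exists2 y, sph y & forall e, e \in B -> O e (tau e) y.
  have [n] := ubnP #|G|; elim: n G x => // n IH G x Gn GB Fx OG.
  have [G0|[g gG]] := set_0Vmem G.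
    by exists x; [exact: flat_sub Fx | move=> e eB; apply: OG; rewrite G0 finset.setD0].
  have /finset.setDP[gB gab] := fintype.subsetP GB _ gG.
  have GgB : G :\ g \subset B.
    apply: fintype.subset_trans (finset.subsetDl _ _) _.
    exact: fintype.subset_trans GB (finset.subsetDl _ _).
  have XE : F (G :\ g) = X (B :\: (G :\ g)).
    by rewrite finset.setDDr finset.setDv finset.set0U (finset.setIidPr GgB).
  have tg : ~ F (G :\ g) `<=` S g.
    rewrite XE; apply: (@coflat_transversal _ g a) => //.
    - by rewrite !finset.inE eqxx gB.
    - rewrite finset.inE aB andbT; apply/negP => /finset.setD1P[_ aG].
      by have := fintype.subsetP GB _ aG; rewrite !finset.inE eqxx.
    - by apply: contraNneq gab => ->; rewrite !finset.inE eqxx.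
  have Fn : F (G :\ g) !=set0 by rewrite XE; apply: coflat_nonempty.
  have Fgx : F (G :\ g) x by apply: flat_mono Fx; apply: finset.subD1set.
  have Sgx : S g x by have /flatP[_] := Fx; apply.
  have [y [Fy Oy pres]] := flat_perturb Fn tg (tau g) Fgx Sgx.
  apply: (IH (G :\ g) y) => //.
  - by move: Gn; rewrite (cardsD1 g) gG.
  - by apply: fintype.subset_trans GB; apply: finset.subsetDl.
  - move=> e /finset.setDP[eB]; rewrite !finset.inE negb_and negbK => /orP[/eqP -> //|eG].
    by apply: pres; apply: OG; rewrite finset.inE eG.
have [y0 Sy0 Oy0] : exists2 y, sph y & forall e, e \in B -> O e (tau e) y.
  apply: (off_B (B :\: [set a; b]) x0) => // e /finset.setDP[eB].
  by rewrite !finset.inE eB andbT negbK => /orP[]/eqP ->.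
have off_all (l : seq 'I_N) : exists y, [/\ sph y, forall e, e \in B -> O e (tau e) y &
    forall e, e \in l -> ~ S e y].
  elim: l => [|e l [y [Sy Oy nS]]]; first by exists y0.
  have [Sey|nSey] := pselect (S e y); last first.
    by exists y; split=> // i; rewrite inE => /orP[/eqP ->|/nS].
  have [F0 te] : F finset.set0 !=set0 /\ ~ F finset.set0 `<=` S e.
    by apply: sphere_transversal; exists y.
  have F0y : F finset.set0 y by rewrite /F flat_set0.
  have [z [Fz Oz pres]] := flat_perturb F0 te true F0y Sey.
  exists z; split; first exact: flat_sub Fz.
    by move=> i iB; apply: pres; apply: Oy.
  move=> i; rewrite inE => /orP[/eqP ->|il]; first exact: open_side_psphere Oz.
  have [s Os] := open_sideP Sy (nS i il).
  exact: open_side_psphere (pres _ _ Os).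
have [y [Sy Oy nS]] := off_all (enum 'I_N); exists y; split=> //.
by apply/arr_complementP; split=> // e; apply: nS; rewrite mem_enum.
Qed.

End Signs.
End Circuit.
End Regions.

Lemma varchenko_cubew (R : realType) (d N : nat) (A : signed_arrangement R d N) :
  varchenko A = \matrix_(i, j) cubew (fun e => Xv e : mpolyZ N)
    [set e | region_sign A (nth classical_sets.set0 (region_seq A) i) e]
    [set e | region_sign A (nth classical_sets.set0 (region_seq A) j) e].
Proof.
apply/matrixP => i j; rewrite !mxE; apply: eq_bigl => e.
by rewrite !finset.inE.
Qed.

Theorem theorem4p2 (R : realType) (d N : nat) (A : signed_arrangement R d N)
    (distinct : injective (psphere A)) (nsg : ~ semigeneral A) :
  ~ has_diagonal_form (varchenko A).
Proof.
have [B [[FB [e0 e0B Fe0]] minB]] := circuit_exists nsg.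
have Bn0 : exists e, e \in B by exists e0.
have Fmono (B' : {set 'I_N}) : B' \subset B -> (flat (psphere A) B' !=set0)%classic.
  by move=> sub; case: FB => x /(flat_mono sub); exists x.
have indep (B' : {set 'I_N}) e : B' \proper B -> e \in B' ->
    ~ (flat (psphere A) (B' :\ e) `<=` psphere A e)%classic.
  move=> B'B eB' sub; apply: (minB B' B'B); split; last by exists e.
  by apply: Fmono; apply: fintype.proper_sub.
have circ e : e \in B -> (flat (psphere A) (B :\ e) `<=` psphere A e)%classic.
  move=> eB; have [->//|ne] := eqVneq e e0.
  (* Exchange over [G] transfers the redundancy of [e0] to [e]; by minimality of [B] neither [S e]
     nor [S e0] contains the flat of [G]. *)
  pose G := B :\ e :\ e0.
  have e0Be : e0 \in B :\ e by rewrite !finset.inE eq_sym ne.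
  have eBe0 : e \in B :\ e0 by rewrite !finset.inE ne.
  have GE : G = B :\ e0 :\ e by apply/setP => x; rewrite !finset.inE andbCA.
  have <- : e0 |: G = B :\ e by rewrite finset.setD1K.
  apply: flat_exchange; [|by rewrite GE; apply: indep => //; apply: finset.properD1| |].
  - apply: Fmono; apply: fintype.subset_trans (finset.subD1set _ _) _.
    exact: finset.subD1set.
  - by apply: indep => //; apply: finset.properD1.
  - by rewrite GE finset.setD1K.
have [c [cB cP]] := circuit_signs Bn0 FB circ indep.
have B3 := circuit_card Bn0 FB circ distinct.
have N0 : (0 < N)%N by case: (N) e0 {e0B Fe0} => // -[].
rewrite varchenko_cubew.
apply: (circuit_no_diagonal_form (C := c) B3 cB) => [i|L LB Lc LBc].
  have [x cx ->] := region_seq_nth i N0; have [Sx nS] := (arr_complementP _ _).1 cx.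
  have missing s : ~ (forall e, e \in B -> open_side A e ((e \in c) (+) s) x).
    apply: (circuit_sign_missing FB circ indep cP (D := B)) => //.
      by apply/set0Pn.
    by apply/flatP; split=> // e; rewrite finset.setDv finset.inE.
  apply/andP; split; apply/eqP => E.
    apply: (missing false) => e eB.
    have := congr1 (fun M : {set 'I_N} => e \in M) E.
    rewrite !finset.inE eB andbT addbF => <-; rewrite region_signP//.
    have [s Os] := open_sideP Sx (nS e).
    by case: asboolP => // nO; case: s Os.
  apply: (missing true) => e eB.
  have := congr1 (fun M : {set 'I_N} => e \in M) E.
  rewrite !finset.inE eB !andbT addbT => <-; rewrite region_signP//.
  have [s Os] := open_sideP Sx (nS e).
  by case: asboolP => // nO; case: s Os.
have [a aLc] := neq_set_mem Lc; have [b bLc] := neq_set_mem LBc.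
have aB : a \in B.
  by apply: contraNT aLc => aB; rewrite !(contraNF (fintype.subsetP _ a) aB).
have bB : b \in B.
  apply: contraNT bLc => bB.
  by rewrite finset.inE (negPf bB) andbF (contraNF (fintype.subsetP LB b) bB).
have tb : (b \in L) = (b \in c).
  by move: bLc; rewrite finset.inE bB andbT; case: (b \in L); case: (b \in c).
have [x [cx Ox]] := circuit_sign_realized FB indep cP (tau := fun e => e \in L) aB bB aLc tb.
have [i ri] := region_seq_index N0 cx; exists i; apply/setP => e.
rewrite !finset.inE ri region_signP//; have [eB|eB] := boolP (e \in B); last first.
  by rewrite andbF (contraNF (fintype.subsetP LB e) eB).
rewrite andbT; apply/asboolP/idP => [Oe|eL]; first exact: open_side_inj (Ox e eB) Oe.
by have := Ox e eB; rewrite eL.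
Qed.
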